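(* Let $\mathcal{M}=hK_\theta$ be a nearly $S^*$-invariant subspace of $H^2$, where $h$ is its extremal function and $\theta$ is the associated inner function, with $\theta(0)=0$. Let $A_z^{\mathcal{M}}$ be the compressed shift on $\mathcal{M}$ and let $v=\langle\theta,|h|^2\rangle$. Then the point spectrum is $\sigma_p(A_z^{\mathcal{M}})=\{\lambda\in\mathbb{D}:\theta(\lambda)=v\}$. For each $\lambda\in\sigma_p(A_z^{\mathcal{M}})$, the corresponding eigenvector is $h\,(Ck_\lambda^\theta)=h\,\widetilde{k_\lambda^\theta}$.
   Context: $H^2=H^2(\mathbb{D})$ is the Hardy space of the unit disc, viewed also as a subspace of $L^2=L^2(\mathbb{T})$; $S$ is the shift $(Sf)(z)=zf(z)$ and $S^*$ is its adjoint. For an inner function $\theta$, $K_\theta=H^2\ominus\theta H^2$, with reproducing kernel $k_\lambda^\theta(z)=\frac{1-\overline{\theta(\lambda)}\theta(z)}{1-\overline{\lambda}z}$. The conjugation $C$ on $K_\theta$ is $Cf=\theta\,\overline{zf}$ (on $\mathbb{T}$), and $\widetilde{k_\lambda^\theta}=Ck_\lambda^\theta=\frac{\theta(z)-\theta(\lambda)}{z-\lambda}$. A closed subspace $\mathcal{M}\subseteq H^2$ is nearly $S^*$-invariant if $f\in\mathcal{M}$ and $f(0)=0$ imply $S^*f\in\mathcal{M}$. Saying that $\mathcal{M}=hK_\theta$ is nearly $S^*$-invariant with extremal function $h$ and associated inner function $\theta$, $\theta(0)=0$, means (Hitt's theorem): $h\in\mathcal{M}$, $\|h\|=1$, $h(0)>0$,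 $h$ is orthogonal to every element of $\mathcal{M}$ vanishing at $0$, and multiplication by $h$ is an isometry of $K_\theta$ onto $\mathcal{M}$. The compressed shift on $\mathcal{M}$ is $A_z^{\mathcal{M}}f=P_{\mathcal{M}}(zf)$, $f\in\mathcal{M}$, where $P_{\mathcal{M}}$ is the orthogonal projection of $L^2$ onto $\mathcal{M}$. The point spectrum $\sigma_p$ is the set of eigenvalues. Here $\langle\theta,|h|^2\rangle=\int_{\mathbb{T}}\theta|h|^2\,dm$ with $m$ normalized Lebesgue measure. *)

(* Defs.v *)
From HB Require Import structures.
From mathcomp Require Import all_boot all_order all_algebra.
From mathcomp Require Import all_classical all_reals all_analysis.
From mathcomp Require Import complex.

Set Implicit Arguments.
Unset Strict Implicit.
Unset Printing Implicit Defensive.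

Import Order.TTheory GRing.Theory Num.Theory.
Import numFieldNormedType.Exports.

Local Open Scope classical_set_scope.
Local Open Scope ring_scope.
Local Open Scope complex_scope.

Section L2_circle.
Context {R : realType}.
Local Notation C := (R[i]).
Local Notation mu := (@lebesgue_measure R).
Local Notation I01 := (`[0%R, 1%R]%classic : set R).

(* A function on the circle is represented by some f : C -> C of which only
   the values on |z| = 1 matter.  The normalized measure dm on the circle is
   the image of Lebesgue measure on [0, 1] under t |-> exp(2 pi i t). *)
Definition circ (t : R) : C := cos (2 * pi * t) +i* sin (2 * pi * t).

Definition meanT (f : C -> C) : C :=
  (\int[mu]_(t in I01) complex.Re (f (circ t))) +i*
  (\int[mu]_(t in I01) complex.Im (f (circ t))).

Definition L2 (f : C -> C) : Prop :=
  [/\ measurable_fun I01 (fun t => complex.Re (f (circ t))),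
      measurable_fun I01 (fun t => complex.Im (f (circ t))) &
      (\int[mu]_(t in I01) ((Normc.normc (f (circ t)) ^+ 2)%:E) < +oo)%E].

Definition eqT (f g : C -> C) : Prop :=
  {ae mu, forall t, I01 t -> f (circ t) = g (circ t)}.

Definition ip (f g : C -> C) : C := meanT (fun z => f z * (g z)^*).

Definition sqnorm (f : C -> C) : R :=
  \int[mu]_(t in I01) (Normc.normc (f (circ t)) ^+ 2).

Definition L2_cvg (u : nat -> C -> C) (f : C -> C) : Prop :=
  sqnorm (fun z => u n z - f z) @[n --> \oo] --> (0 : R).

(* Elements of [L2] are functions rather than classes, hence the closure
   under almost everywhere equality. *)
Definition closed_subspace (M : set (C -> C)) : Prop :=
  [/\ M `<=` L2,
      M (fun=> 0),
      forall (a : C) f g, M f -> M g -> M (fun z => a * f z + g z),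
      forall f g, M f -> L2 g -> eqT f g -> M g &
      forall u f, (forall n, M (u n)) -> L2 f -> L2_cvg u f -> M f].

(* The orthogonal projection of f onto M; M is meant to be a closed
   subspace, so that the set below is one class modulo [eqT]. *)
Definition proj (M : set (C -> C)) (f : C -> C) : C -> C :=
  xget (fun=> 0) [set p | M p /\ forall q, M q -> ip (fun z => f z - p z) q = 0].

End L2_circle.

Section Hardy.
Context {R : realType}.
Local Notation C := (R[i]).

Definition fourier (f : C -> C) (n : nat) : C := ip f (fun z => z ^+ n).

(* H^2 inside L^2: the L^2-sums of series \sum_(n >= 0) a_n z^n.  The a_n are
   then the Fourier coefficients of f, and are square-summable. *)
Definition hardy (f : C -> C) : Prop :=
  L2 f /\ L2_cvg (fun N z => \sum_(n < N) fourier f n * z ^+ n) f.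

(* The value at a point of the open disc of the analytic function with
   boundary function f, as the sum of its Taylor series. *)
Definition disc (f : C -> C) (w : C) : C :=
  let S N := \sum_(n < N) fourier f n * w ^+ n in
  limn (fun N => complex.Re (S N)) +i* limn (fun N => complex.Im (S N)).

Definition shift (f : C -> C) : C -> C := fun z => z * f z.

(* The adjoint of the shift on H^2. *)
Definition shift_adj (f : C -> C) : C -> C :=
  xget (fun=> 0)
    [set g | hardy g /\ forall k, hardy k -> ip (shift k) f = ip k g].

Definition nearly_invariant (M : set (C -> C)) : Prop :=
  [/\ closed_subspace M, M `<=` hardy &
      forall f, M f -> disc f 0 = 0 -> M (shift_adj f)].

Definition inner_fun (theta : C -> C) : Prop :=
  [/\ hardy theta,
      exists B : C, forall w, `|w| < 1 -> `|disc theta w| <= B &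
      eqT (fun z => `|theta z|) (fun=> 1)].

Definition Kspace (theta : C -> C) : set (C -> C) :=
  [set g | hardy g /\ forall f, hardy f -> ip g (fun z => theta z * f z) = 0].

Definition mulK (h theta : C -> C) : set (C -> C) :=
  [set f | L2 f /\ exists g, Kspace theta g /\ eqT f (fun z => h z * g z)].

Definition kernelK (theta : C -> C) (w : C) : C -> C :=
  fun z => (1 - (disc theta w)^* * theta z) / (1 - w^* * z).

Definition conjK (theta f : C -> C) : C -> C :=
  fun z => theta z * (z * f z)^*.

Definition kernelK_tilde (theta : C -> C) (w : C) : C -> C :=
  fun z => (theta z - disc theta w) / (z - w).

(* M = h K_theta in the sense of Hitt's theorem, with h extremal. *)
Definition hitt (M : set (C -> C)) (h theta : C -> C) : Prop :=
  [/\ [/\ M h, sqnorm h = 1, 0 < disc h 0 &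
          forall f, M f -> disc f 0 = 0 -> ip h f = 0],
      inner_fun theta, disc theta 0 = 0,
      M = mulK h theta &
      forall g, Kspace theta g ->
        M (fun z => h z * g z) /\ sqnorm (fun z => h z * g z) = sqnorm g].

Definition compressed_shift (M : set (C -> C)) (f : C -> C) : C -> C :=
  proj M (shift f).

Definition eigenvector (M : set (C -> C)) (w : C) (f : C -> C) : Prop :=
  [/\ M f, ~ eqT f (fun=> 0) &
      eqT (compressed_shift M f) (fun z => w * f z)].

Definition point_spectrum (M : set (C -> C)) : set C :=
  [set w | exists f, eigenvector M w f].

End Hardy.

(* Main.v *)
(* Write f = h g with g in K_theta.  Then z g = g1 + c theta with g1 in K_theta
   and c = <z g, theta>.  The projection of h theta onto M is v h: if k lies in
   K_theta and k(0) = 0 then theta conj(k) lies in K_theta, so that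
   <h theta, h k> = <h theta conj(k), h> = <theta conj(k), 1> = 0 because
   multiplication by h is isometric.  Hence A_z(h g) = h (g1 + c v), and the
   eigenvalue equation at w becomes (z - w) g = c (theta - v), which for
   |w| < 1 is solvable in K_theta exactly when theta(w) = v.
   A contraction argument excludes |w| > 1; for |w| = 1 the equality case gives
   z f = w f, which kills all the Taylor coefficients of f. *)
Require Import Defs.
From HB Require Import structures.
From mathcomp Require Import all_boot all_order all_algebra.
From mathcomp Require Import all_classical all_reals all_analysis.
From mathcomp Require Import complex.
From mathcomp Require Import measurable_realfun ring lra.
Import Order.TTheory GRing.Theory Num.Theory.
Import numFieldNormedType.Exports.
Local Open Scope classical_set_scope.
Local Open Scope ring_scope.
Local Open Scope complex_scope.

(** Only boundary values are at hand: [disc] is a limit of Taylor sums and [hardy] asks for L2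
    convergence of such sums. [disc_cauchy] turns a value in the disc into a mean over the circle,
    so [theta(w) - v] becomes the Fourier coefficient of index -1 of [(theta - v) / (z - w)]; its
    vanishing is the whole obstruction to that quotient lying in H^2. Conversely, H^2 membership is
    deduced from vanishing negative coefficients only for L2 limits of Laurent polynomials, which is
    why [theta conj(k)] and [(theta - v) / (z - w)] are each approximated explicitly beforehand. The
    condition [theta(0) = 0] acts twice: it puts the constant 1 in K_theta, so that pairings with
    [h = h 1] can be carried back through the isometry, and it keeps [theta] from being constant, so
    that the candidate eigenvector is not zero. *)

Section Circle.
(* [ring_scope] on top of [complex_scope], so that [x^*] is always [Num.conj]
   rather than [conjc], as it already is under [*] in the definitions. *)
Local Open Scope ring_scope.
Context {R : realType}.
Local Notation C := (R[i]).
Local Notation mu := (@lebesgue_measure R).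
Local Notation I01 := (`[0%R, 1%R]%classic : set R).
Local Notation re := complex.Re.
Local Notation im := complex.Im.
Implicit Types (f g u : C -> C) (a w z : C) (p q : {poly C}).

(** * Mean values and L2 on the circle *)

Lemma complexP (x y : C) : re x = re y -> im x = im y -> x = y.
Proof. by case: x y => [a b] [c d] /= -> ->. Qed.

Lemma ReD (x y : C) : re (x + y) = re x + re y. Proof. by case: x y => [a b] []. Qed.
Lemma ImD (x y : C) : im (x + y) = im x + im y. Proof. by case: x y => [a b] []. Qed.
Lemma ReN (x : C) : re (- x) = - re x. Proof. by case: x. Qed.
Lemma ImN (x : C) : im (- x) = - im x. Proof. by case: x. Qed.
Lemma ReM (x y : C) : re (x * y) = re x * re y - im x * im y.
Proof. by case: x y => [a b] []. Qed.
Lemma ImM (x y : C) : im (x * y) = re x * im y + im x * re y.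
Proof. by case: x y => [a b] [c d]. Qed.
Lemma ReJ (x : C) : re x^* = re x. Proof. by case: x. Qed.
Lemma ImJ (x : C) : im x^* = - im x. Proof. by case: x. Qed.

Lemma normc_sqr (x : C) : Normc.normc x ^+ 2 = re x ^+ 2 + im x ^+ 2.
Proof. by case: x => a b /=; rewrite sqr_sqrtr// addr_ge0 ?sqr_ge0. Qed.

Lemma normc_ge0 (x : C) : 0 <= Normc.normc x.
Proof. by case: x => a b /=; exact: sqrtr_ge0. Qed.

Lemma normcJc (x : C) : Normc.normc x^* = Normc.normc x.
Proof. by case: x => a b /=; rewrite sqrrN. Qed.

Lemma mulcJ_normc (x : C) : x * x^* = (Normc.normc x ^+ 2)%:C.
Proof.
apply: complexP; rewrite ?(ReM, ImM, ReJ, ImJ, normc_sqr) /=; ring.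
Qed.

Lemma circ1 (t : R) : circ t * (circ t)^* = 1.
Proof.
by rewrite mulcJ_normc normc_sqr /= cos2Dsin2.
Qed.

Definition measT f := measurable_fun I01 (fun t => re (f (circ t))) /\
  measurable_fun I01 (fun t => im (f (circ t))).

Lemma measT_cst a : measT (fun=> a).
Proof. by split; exact: measurable_cst. Qed.

Let eqmf (F G : R -> R) : F =1 G -> measurable_fun I01 G -> measurable_fun I01 F.
Proof. by move=> /funext ->. Qed.

Lemma measTD f g : measT f -> measT g -> measT (fun z => f z + g z).
Proof.
move=> [f1 f2] [g1 g2]; split.
  by apply: (eqmf _ _ (fun t => ReD _ _)); exact: measurable_funD.
by apply: (eqmf _ _ (fun t => ImD _ _)); exact: measurable_funD.
Qed.

Lemma measTM f g : measT f -> measT g -> measT (fun z => f z * g z).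
Proof.
move=> [f1 f2] [g1 g2]; split.
  apply: (eqmf _ _ (fun t => ReM _ _)).
  by apply: measurable_funB; exact: measurable_funM.
apply: (eqmf _ _ (fun t => ImM _ _)).
by apply: measurable_funD; exact: measurable_funM.
Qed.

Lemma measTJ f : measT f -> measT (fun z => (f z)^*).
Proof.
move=> [f1 f2]; split.
  exact: (eqmf _ _ (fun t => ReJ _)).
by apply: (eqmf _ _ (fun t => ImJ _)); exact: measurable_funN.
Qed.

Lemma measT_id : measT id.
Proof.
split => /=; apply: measurable_funTS; apply: continuous_measurable_fun => t.
  apply: (@continuous_comp _ _ _ (fun t : R => 2 * pi * t) cos).
    exact: mulrl_continuous.
  exact: continuous_cos.
apply: (@continuous_comp _ _ _ (fun t : R => 2 * pi * t) sin).
  exact: mulrl_continuous.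
exact: continuous_sin.
Qed.

Lemma measTX f n : measT f -> measT (fun z => f z ^+ n).
Proof.
move=> mf; elim: n => [|n IH]; first exact: measT_cst.
rewrite (_ : (fun z => _) = (fun z => f z * f z ^+ n)); first exact: measTM.
by apply/funext => z; rewrite exprS.
Qed.

Lemma normC_lt1 w : `|w| < 1 -> Normc.normc w < 1.
Proof. by rewrite -ltcR. Qed.

Lemma normc_unit z : z * z^* = 1 -> Normc.normc z = 1.
Proof.
rewrite mulcJ_normc => /complexI z1; apply/eqP.
by rewrite -(@eqrXn2 _ 2) ?normc_ge0// z1 expr1n.
Qed.

Lemma unit_neq w z : `|w| < 1 -> z * z^* = 1 -> z - w != 0.
Proof.
move=> /normC_lt1 w1 /normc_unit z1; rewrite subr_eq0; apply/eqP => zw.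
by rewrite -zw z1 ltxx in w1.
Qed.

Lemma measT_inv w : `|w| < 1 -> measT (fun z => (z - w)^-1).
Proof.
move=> w1.
(* Conjugate over squared modulus: only the continuity of a real function remains to be proved. At
   [z = w] both sides are 0. *)
have E z : (z - w)^-1 = (z - w)^* * ((re (z - w) ^+ 2 + im (z - w) ^+ 2)^-1)%:C.
  rewrite -normc_sqr; have [->|z0] := eqVneq (z - w) 0; first by rewrite invr0 rmorph0 mul0r.
  apply: (mulfI z0); rewrite divff// mulrA mulcJ_normc -rmorphM /= divff//.
  by rewrite expf_eq0 /=; apply: contra_neq z0 => /Normc.eq0_normc.
rewrite (funext E).
apply: measTM; first by apply/measTJ/measTD; [exact: measT_id|exact: measT_cst].
split; last exact: measurable_cst.
apply: measurable_funTS; apply: continuous_measurable_fun => t /=.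
have cc : {for t, continuous (fun t : R => re (circ t))}.
  apply: (@continuous_comp _ _ _ (fun t : R => 2 * pi * t) cos).
    exact: mulrl_continuous.
  exact: continuous_cos.
have cs : {for t, continuous (fun t : R => im (circ t))}.
  apply: (@continuous_comp _ _ _ (fun t : R => 2 * pi * t) sin).
    exact: mulrl_continuous.
  exact: continuous_sin.
apply: cvgV.
  rewrite -normc_sqr expf_eq0 /=; apply/eqP => /Normc.eq0_normc/eqP.
  by apply/negP; apply: unit_neq => //; exact: circ1.
have E1 (r : R) : re (circ r - w) = re (circ r) - re w by rewrite ReD ReN.
have E2 (r : R) : im (circ r - w) = im (circ r) - im w by rewrite ImD ImN.
rewrite (_ : (fun x => _) = (fun x => (re (circ x) - re w) ^+ 2 + (im (circ x) - im w) ^+ 2)); last first.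
  by apply/funext => r; rewrite E1 E2.
rewrite E1 E2; apply: cvgD; apply: cvgM; apply: cvgB; solve [exact: cvg_cst|exact: cc|exact: cs].
Qed.

Lemma aeS (P Q : R -> Prop) : (forall t, P t -> Q t) ->
  {ae mu, forall t, P t} -> {ae mu, forall t, Q t}.
Proof. exact: (@filterS _ _ (ae_filter_ringOfSetsType mu)). Qed.

Lemma aeS2 (P Q S : R -> Prop) : (forall t, P t -> Q t -> S t) ->
  {ae mu, forall t, P t} -> {ae mu, forall t, Q t} -> {ae mu, forall t, S t}.
Proof. exact: (@filterS2 _ _ (ae_filter_ringOfSetsType mu)). Qed.

Let mI01 : measurable (I01 : set (measurableTypeR R)).
Proof. exact: measurable_itv. Qed.

Definition intT f := mu.-integrable I01 (EFin \o (fun t => re (f (circ t)))) /\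
  mu.-integrable I01 (EFin \o (fun t => im (f (circ t)))).

Let eqint (F G : R -> R) : F =1 G -> mu.-integrable I01 (EFin \o G) ->
  mu.-integrable I01 (EFin \o F).
Proof. by move=> /funext ->. Qed.

Let eqRint (F G : R -> R) : F =1 G ->
  \int[mu]_(t in I01) F t = \int[mu]_(t in I01) G t.
Proof. by move=> /funext ->. Qed.

Let rintD (F G : R -> R) : mu.-integrable I01 (EFin \o F) ->
  mu.-integrable I01 (EFin \o G) ->
  mu.-integrable I01 (EFin \o (fun t => F t + G t)).
Proof. by move=> iF iG; exact: (integrableD mI01 iF iG). Qed.

Let rintZ (r : R) (F : R -> R) : mu.-integrable I01 (EFin \o F) ->
  mu.-integrable I01 (EFin \o (fun t => r * F t)).
Proof. by move=> iF; exact: (integrableZl mI01 r iF). Qed.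

Let rintB (F G : R -> R) : mu.-integrable I01 (EFin \o F) ->
  mu.-integrable I01 (EFin \o G) ->
  mu.-integrable I01 (EFin \o (fun t => F t - G t)).
Proof. by move=> iF iG; exact: (integrableB mI01 iF iG). Qed.

(** Points of the circle are known only through [z * z^* = 1], which makes identities under the mean
    a matter of algebra. *)
Lemma meanT_eq f g : (forall z, z * z^* = 1 -> f z = g z) -> meanT f = meanT g.
Proof.
move=> fg; rewrite /meanT; congr (_ +i* _); apply: eqRint => t;
  by rewrite fg// circ1.
Qed.

Lemma intTZ a f : intT f -> intT (fun z => a * f z).
Proof.
move=> [f1 f2]; split.
  apply: (eqint _ _ (fun t => ReM _ _)).
  by apply: rintB => //; exact: rintZ.
apply: (eqint _ _ (fun t => ImM _ _)).
by apply: rintD => //; exact: rintZ.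
Qed.

Lemma meanTD f g : intT f -> intT g ->
  meanT (fun z => f z + g z) = meanT f + meanT g.
Proof.
move=> [f1 f2] [g1 g2]; rewrite /meanT; congr (_ +i* _).
  by rewrite (eqRint _ _ (fun t => ReD _ _)) RintegralD.
by rewrite (eqRint _ _ (fun t => ImD _ _)) RintegralD.
Qed.

Lemma meanTZ a f : intT f -> meanT (fun z => a * f z) = a * meanT f.
Proof.
move=> [f1 f2]; apply: complexP; rewrite ?ReM ?ImM /meanT /=.
  by rewrite (eqRint _ _ (fun t => ReM _ _)) RintegralB ?RintegralZl//;
    exact: rintZ.
by rewrite (eqRint _ _ (fun t => ImM _ _)) RintegralD ?RintegralZl//;
    exact: rintZ.
Qed.

Lemma meanTJ f : intT f -> meanT (fun z => (f z)^*) = (meanT f)^*.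
Proof.
move=> [f1 f2]; rewrite /meanT /=; congr (_ +i* _).
  exact: (eqRint _ _ (fun t => ReJ _)).
rewrite (eqRint _ (fun t => -1 * im (f (circ t)))) ?RintegralZl ?mulN1r// => t.
by rewrite mulN1r ImJ.
Qed.

Lemma meanT_eqT f g : measT f -> measT g -> eqT f g -> meanT f = meanT g.
Proof.
move=> [f1 f2] [g1 g2] fg; rewrite /meanT; congr (_ +i* _); congr fine;
  apply: ae_eq_integral => //; try exact/measurable_EFinP;
  by apply: aeS fg => t /= fg It; rewrite fg.
Qed.

Lemma meanT_cst a : meanT (fun=> a) = a.
Proof.
have m1 : fine (mu I01) = 1 by rewrite lebesgue_measure_itv /= lte_fin ltr01 oppr0 addr0.
by rewrite /meanT !Rintegral_cst// m1 !mulr1; case: a.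
Qed.

(** * Square-integrable functions *)

Lemma L2_meas f : L2 f -> measT f.
Proof. by case. Qed.

Let mnsq f : measT f ->
  measurable_fun I01 (EFin \o (fun t => Normc.normc (f (circ t)) ^+ 2)).
Proof.
move=> [f1 f2]; apply/measurable_EFinP.
rewrite (_ : (fun t => _) = (fun t => re (f (circ t)) ^+ 2 + im (f (circ t)) ^+ 2)).
  by apply: measurable_funD; exact: measurable_funX.
by apply/funext => t; rewrite normc_sqr.
Qed.

Lemma L2P f : L2 f <-> measT f /\
  mu.-integrable I01 (EFin \o (fun t => Normc.normc (f (circ t)) ^+ 2)).
Proof.
split => [[f1 f2 f3]|[[f1 f2] /integrableP[_ f3]]]; split => //.
  apply/integrableP; split; first exact: mnsq.
  apply: le_lt_trans f3; under eq_integral do rewrite /= ger0_norm ?sqr_ge0//.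
  by [].
apply: le_lt_trans f3; under [leRHS]eq_integral do rewrite /= ger0_norm ?sqr_ge0//.
by [].
Qed.

Lemma intTM f g : L2 f -> L2 g -> intT (fun z => f z * g z).
Proof.
move=> /L2P[mf f1] /L2P[mg g1].
have [m1 m2] := measTM f g mf mg.
(* Both parts of the product are dominated by [|f|^2 + |g|^2]; the squares listed below supply [nra]
   with bounds on [a c - b d] and [a d + b c]. *)
have H := rintD _ _ f1 g1.
split; [apply: le_integrable H => //; first exact/measurable_EFinP |
  apply: le_integrable H => //; first exact/measurable_EFinP] => t _ /=;
  rewrite lee_fin [leRHS]ger0_norm ?addr_ge0 ?sqr_ge0// !normc_sqr ?ReM ?ImM ler_norml;
  move: (re (f _)) (im (f _)) (re (g _)) (im (g _)) => a b c d;
  have := (sqr_ge0 (a - c), sqr_ge0 (a + c), sqr_ge0 (b - d), sqr_ge0 (b + d),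
    sqr_ge0 (a - d), sqr_ge0 (a + d), sqr_ge0 (b - c), sqr_ge0 (b + c),
    sqr_ge0 a, sqr_ge0 b, sqr_ge0 c, sqr_ge0 d) => H1;
  move: H1 => [[[[[[[[[[[]]]]]]]]]]] *; apply/andP; split; nra.
Qed.

(** Common source of the stability properties of L2: with [B = 1] it covers almost everywhere
    equality, conjugation and unimodular factors, and with general [B] bounded multipliers. *)
Lemma L2_dom (B : R) f g : measT g -> L2 f ->
  {ae mu, forall t, I01 t -> Normc.normc (g (circ t)) <= B * Normc.normc (f (circ t))} ->
  L2 g /\ sqnorm g <= B ^+ 2 * sqnorm f.
Proof.
move=> mg /L2P[mf f1] H.
have iBf : mu.-integrable I01 (EFin \o (fun t => B ^+ 2 * Normc.normc (f (circ t)) ^+ 2)).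
  exact: rintZ.
have le : (\int[mu]_(t in I01) (Normc.normc (g (circ t)) ^+ 2)%:E <=
  \int[mu]_(t in I01) (B ^+ 2 * Normc.normc (f (circ t)) ^+ 2)%:E)%E.
  apply: ae_ge0_le_integral => //.
  - by move=> t _; rewrite lee_fin sqr_ge0.
  - exact: mnsq.
  - by move=> t _; rewrite lee_fin mulr_ge0 ?sqr_ge0.
  - by case/integrableP: iBf.
  apply: aeS H => t H It; rewrite lee_fin -exprMn.
  have := H It => Ht; rewrite ler_sqr ?nnegrE// ?normc_ge0//.
  exact: le_trans (normc_ge0 _) Ht.
have fin : (\int[mu]_(t in I01) (B ^+ 2 * Normc.normc (f (circ t)) ^+ 2)%:E < +oo)%E.
  by have := integrable_fin_num mI01 iBf; rewrite fin_numE ltey => /andP[].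
have Lg : L2 g by case: mg => g1 g2; split => //; exact: le_lt_trans fin.
split=> //; rewrite -RintegralZl// /sqnorm /Rintegral fine_le//.
  by case/L2P: Lg => _ /(integrable_fin_num mI01).
exact: integrable_fin_num.
Qed.

Lemma sqnorm_ge0 f : 0 <= sqnorm f.
Proof. by apply: Rintegral_ge0 => t _; exact: sqr_ge0. Qed.

Lemma L2D f g : L2 f -> L2 g -> L2 (fun z => f z + g z).
Proof.
move=> /[dup] /L2_meas mf /L2P[_ f1] /[dup] /L2_meas mg /L2P[_ g1].
apply/L2P; have mD := measTD f g mf mg; split => //.
have H := rintZ 2 _ (rintD _ _ f1 g1).
apply: le_integrable H => //; first exact: (mnsq _ mD).
move=> t _ /=; rewrite lee_fin ger0_norm ?sqr_ge0//.
rewrite ger0_norm ?mulr_ge0 ?addr_ge0 ?sqr_ge0// !normc_sqr ReD ImD.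
move: (re (f _)) (im (f _)) (re (g _)) (im (g _)) => a b c d.
have := (sqr_ge0 (a - c), sqr_ge0 (b - d)) => -[*]; nra.
Qed.

Lemma eqT_refl f : eqT f f.
Proof. by apply: aeW => t. Qed.

Lemma L2Mb (B : R) f g : L2 f -> measT g ->
  (forall z, z * z^* = 1 -> Normc.normc (g z) <= B) -> L2 (fun z => g z * f z).
Proof.
move=> Lf mg gB; apply: (proj1 (L2_dom B f _ _ Lf _)).
  by apply: measTM => //; exact: L2_meas.
by apply: aeW => t _; rewrite Normc.normcM ler_wpM2r ?normc_ge0// gB ?circ1.
Qed.

Lemma L2Z a f : L2 f -> L2 (fun z => a * f z).
Proof. by move=> Lf; apply: (L2Mb (Normc.normc a)) => //; exact: measT_cst. Qed.

Lemma L2_cst a : L2 (fun=> a).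
Proof.
apply/L2P; split; first exact: measT_cst.
by apply: continuous_compact_integrable; [exact: segment_compact|move=> ?; exact: cvg_cst].
Qed.

Lemma L2N f : L2 f -> L2 (fun z => - f z).
Proof.
by move=> /(L2Z (-1)); rewrite (_ : (fun z => -1 * f z) = (fun z => - f z))//;
  apply/funext => z; rewrite mulN1r.
Qed.

Lemma L2J f : L2 f -> L2 (fun z => (f z)^*).
Proof.
move=> Lf; apply: (proj1 (L2_dom 1 f _ _ Lf _)); first exact/measTJ/L2_meas.
by apply: aeW => t _; rewrite normcJc mul1r.
Qed.

Lemma L2_eqT f g : L2 f -> measT g -> eqT f g -> L2 g.
Proof.
move=> Lf mg fg; apply: (proj1 (L2_dom 1 f _ mg Lf _)).
by apply: aeS fg => t fg It; rewrite mul1r fg.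
Qed.

Lemma sqnorm_eqT f g : L2 f -> measT g -> eqT f g -> sqnorm f = sqnorm g.
Proof.
move=> Lf mg fg; have Lg := L2_eqT f g Lf mg fg.
have [_ h1] : L2 g /\ sqnorm g <= 1 ^+ 2 * sqnorm f.
  by apply: L2_dom => //; apply: aeS fg => t fg It; rewrite mul1r fg.
have [_ h2] : L2 f /\ sqnorm f <= 1 ^+ 2 * sqnorm g.
  by apply: L2_dom => //; [exact: L2_meas|apply: aeS fg => t fg It; rewrite mul1r fg].
by apply/eqP; rewrite eq_le; move: h1 h2; rewrite expr1n !mul1r => -> ->.
Qed.

Lemma unimodT g : eqT (fun z => `|g z|) (fun=> 1) ->
  {ae mu, forall t, I01 t -> g (circ t) * (g (circ t))^* = 1}.
Proof. by apply: aeS => t g1 It; rewrite -sqr_normc g1// expr1n. Qed.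

Lemma L2_unimod f g : L2 f -> measT g ->
  eqT (fun z => `|g z|) (fun=> 1) -> L2 (fun z => g z * f z).
Proof.
move=> Lf mg g1; apply: (proj1 (L2_dom 1 f _ _ Lf _)).
  by apply: measTM => //; exact: L2_meas.
apply: aeS (unimodT g g1) => t gt It.
by rewrite Normc.normcM (normc_unit _ (gt It)).
Qed.

(** * The inner product and its norm *)

Lemma ip_sym f g : L2 f -> L2 g -> ip g f = (ip f g)^*.
Proof.
move=> Lf Lg; rewrite /ip -meanTJ; last by apply: intTM => //; exact: L2J.
by apply: meanT_eq => z _; rewrite rmorphM/= conjCK mulrC.
Qed.

Lemma ip_linl a f g u : L2 f -> L2 g -> L2 u ->
  ip (fun z => f z + a * g z) u = ip f u + a * ip g u.
Proof.
move=> Lf Lg /L2J Lu; rewrite /ip -meanTZ; last exact: intTM.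
rewrite -meanTD; [|exact: intTM|by apply/intTZ/intTM].
by apply: meanT_eq => z _; ring.
Qed.

Lemma ip_linr a f g u : L2 f -> L2 g -> L2 u ->
  ip u (fun z => f z + a * g z) = ip u f + a^* * ip u g.
Proof.
move=> Lf Lg Lu; have LZ : L2 (fun z => f z + a * g z) by apply: L2D => //; exact: L2Z.
by rewrite (ip_sym _ u LZ Lu) ip_linl// rmorphD rmorphM/= (ip_sym f u)// (ip_sym g u).
Qed.

Lemma ipBl f g u : L2 f -> L2 g -> L2 u ->
  ip (fun z => f z - g z) u = ip f u - ip g u.
Proof.
move=> Lf Lg Lu; rewrite -mulN1r -ip_linl//.
by apply: meanT_eq => z _; rewrite mulN1r.
Qed.

Lemma ipZl a f u : L2 f -> L2 u -> ip (fun z => a * f z) u = a * ip f u.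
Proof.
move=> Lf /L2J Lu; rewrite /ip -meanTZ; last exact: intTM.
by apply: meanT_eq => z _; rewrite mulrA.
Qed.

Lemma ip_sqnorm f : ip f f = (sqnorm f)%:C.
Proof.
apply: complexP; rewrite /ip /meanT/= /sqnorm.
  congr fine; apply: eq_integral => t _.
  by rewrite normc_sqr ReM ReJ ImJ; congr EFin; ring.
rewrite -[RHS](mul0r (fine (mu I01))) -Rintegral_cst; last exact: measurable_itv.
congr fine; apply: eq_integral => t _.
by rewrite ImM ReJ ImJ; congr EFin; ring.
Qed.

(** The scalar stays complex because varying it recovers [ip f g] from norms; this is how the
    isometry is polarized later. *)
Lemma sqnorm_lin a f g : L2 f -> L2 g ->
  sqnorm (fun z => f z + a * g z) =
  sqnorm f + Normc.normc a ^+ 2 * sqnorm g + 2 * re (a^* * ip f g).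
Proof.
move=> Lf Lg; have LZ : L2 (fun z => f z + a * g z) by apply: L2D => //; exact: L2Z.
apply: complexI; rewrite -ip_sqnorm ip_linl// !ip_linr//.
rewrite (ip_sym f g)// !ip_sqnorm.
by apply: complexP; rewrite normc_sqr !(ReM, ImM, ReD, ImD, ReJ, ImJ) /=; ring.
Qed.

Lemma sqnormB f g : L2 f -> L2 g ->
  sqnorm (fun z => f z - g z) = sqnorm f + sqnorm g - 2 * re (ip f g).
Proof.
move=> Lf Lg; have := sqnorm_lin (-1) f g Lf Lg.
have -> : (fun z => f z + -1 * g z) = (fun z => f z - g z).
  by apply/funext => z; rewrite mulN1r.
by move=> ->; rewrite normc_sqr !(ReM, ReJ, ImJ)/=; ring.
Qed.

Lemma sqnormD f g : L2 f -> L2 g ->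
  sqnorm (fun z => f z + g z) = sqnorm f + sqnorm g + 2 * re (ip f g).
Proof.
move=> Lf Lg; have := sqnorm_lin 1 f g Lf Lg.
have -> : (fun z => f z + 1 * g z) = (fun z => f z + g z).
  by apply/funext => z; rewrite mul1r.
by move=> ->; rewrite normc_sqr !(ReM, ReJ, ImJ)/=; ring.
Qed.

Lemma sqnormZ a f : L2 f ->
  sqnorm (fun z => a * f z) = Normc.normc a ^+ 2 * sqnorm f.
Proof.
move=> Lf; have LZ := L2Z a f Lf.
apply: complexI; rewrite -ip_sqnorm ipZl// (ip_sym _ f LZ Lf) ipZl// ip_sqnorm.
by apply: complexP; rewrite normc_sqr !(ReM, ImM, ReJ, ImJ) /=; ring.
Qed.

Lemma sqnormD_le f g : L2 f -> L2 g ->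
  sqnorm (fun z => f z + g z) <= 2 * (sqnorm f + sqnorm g).
Proof.
move=> Lf Lg; have := sqnorm_ge0 (fun z => f z - g z).
by rewrite sqnormB// sqnormD//; lra.
Qed.

(* Expand 0 <= |f - t <f, g> g|^2; when g = 0, letting t grow gives <f, g> = 0. *)
Lemma cauchy_schwarz f g : L2 f -> L2 g ->
  Normc.normc (ip f g) ^+ 2 <= sqnorm f * sqnorm g.
Proof.
move=> Lf Lg; set c := ip f g.
have H (t : R) : 0 <= sqnorm f + t ^+ 2 * Normc.normc c ^+ 2 * sqnorm g - 2 * t * Normc.normc c ^+ 2.
  have := sqnorm_ge0 (fun z => f z + (- t%:C * c) * g z).
  rewrite sqnorm_lin// -/c !normc_sqr !(ReM, ImM, ReN, ImN, ReJ, ImJ) /=.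
  by congr (_ <= _); ring.
have [G0|G0] := eqVneq (sqnorm g) 0.
  rewrite G0 mulr0 leNgt; apply/negP => c0.
  move: c0 H; rewrite G0; move: (_ ^+ 2) (sqnorm f) => k F k0 H.
  (* This [t] makes the linear term [F + 1], so the bound would read [0 <= F - (F + 1)]. *)
  have := H ((F + 1) / (2 * k)); rewrite mulr0 addr0.
  rewrite (_ : 2 * _ * _ = F + 1); first lra.
  by field; rewrite gt_eqF.
(* The minimizer in [t] of the quadratic in [H]. *)
have := H (sqnorm g)^-1; have G1 : 0 < sqnorm g by rewrite lt_def G0 sqnorm_ge0.
rewrite (_ : _ - _ = (sqnorm f * sqnorm g - Normc.normc c ^+ 2) / sqnorm g); last by field.
by rewrite pmulr_lge0 ?invr_gt0// subr_ge0.
Qed.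

Lemma sqnorm_eq0 f : L2 f -> sqnorm f = 0 -> eqT f (fun=> 0).
Proof.
move=> /L2P[mf /[dup] iF /integrableP[mF _]] f0.
have mI : measurable (I01 : set (measurableTypeR R)) by exact: measurable_itv.
pose F := EFin \o (fun t => Normc.normc (f (circ t)) ^+ 2).
have : (\int[mu]_(t in I01) `|F t| = 0)%E.
  under eq_integral do rewrite /= ger0_norm ?sqr_ge0//.
  rewrite -[LHS]fineK; first by congr EFin.
  exact: integrable_fin_num.
move/(ae_eq_integral_abs mu mI mF); apply: aeS => t H It.
have [/eqP] := H It; rewrite sqrf_eq0 => /eqP.
exact: Normc.eq0_normc.
Qed.

(** * Means of powers *)

Lemma circD (s t : R) : circ (s + t) = circ s * circ t.
Proof.
by apply: complexP; rewrite ?(ReM, ImM)/= mulrDr ?cosD ?sinD//; ring.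
Qed.

Lemma circX (t : R) n : circ t ^+ n = circ (n%:R * t).
Proof.
elim: n => [|n IH].
  by rewrite expr0 mul0r; apply: complexP; rewrite /= mulr0 ?cos0 ?sin0.
by rewrite exprS IH -circD; congr circ; rewrite -natr1; ring.
Qed.

Lemma Rintegral_derive (F F' : R -> R) : (forall t : R, is_derive t (1 : R) F (F' t)) ->
  continuous F' -> \int[mu]_(t in I01) F' t = F 1 - F 0.
Proof.
move=> dF cF'; rewrite /Rintegral (@continuous_FTC2 _ F' F 0 1)//.
- exact: continuous_subspaceT.
- have cF : continuous F.
    by move=> t; apply: differentiable_continuous; apply/derivable1_diffP; case: (dF t).
  split; first by move=> t _; case: (dF t).
  + exact/cvg_at_right_filter/cF.
  + exact/cvg_at_left_filter/cF.
- by move=> t _; rewrite derive1E; exact: derive_val.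
Qed.

(** For a positive exponent, de Moivre leaves [cos (k t)] and [sin (k t)], whose primitives take
    equal values at 0 and 1 because [k] is a multiple of [2 pi]. *)
Lemma meanT_expr n : meanT (fun z => z ^+ n) = (n == 0)%:R.
Proof.
case: n => [|n]; first by rewrite (meanT_eq _ (fun=> 1))// meanT_cst.
rewrite /meanT.
have k0 : 2 * pi * n.+1%:R != 0 :> R.
  by rewrite !mulf_neq0 ?pnatr_eq0// gt_eqF// pi_gt0.
have c1 : circ (n.+1%:R * 1) = 1 :> C.
  rewrite -circX (_ : circ 1 = 1) ?expr1n//.
  by apply: complexP; rewrite /= mulr1 mulrC ?mulr_natr ?cos2pi ?sin2pi.
have [ck sk] : cos (2 * pi * n.+1%:R) = 1 :> R /\ sin (2 * pi * n.+1%:R) = 0 :> R.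
  by move: c1; rewrite mulr1 => -[-> ->].
set k := 2 * pi * n.+1%:R in k0 ck sk.
have E t : circ t ^+ n.+1 = cos (k * t) +i* sin (k * t).
  by rewrite circX /circ mulrA.
have -> : \int[mu]_(t in I01) re (circ t ^+ n.+1) = \int[mu]_(t in I01) cos (k * t).
  by congr fine; apply: eq_integral => t _; rewrite E.
have -> : \int[mu]_(t in I01) im (circ t ^+ n.+1) = \int[mu]_(t in I01) sin (k * t).
  by congr fine; apply: eq_integral => t _; rewrite E.
have -> : \int[mu]_(t in I01) cos (k * t) = sin (k * 1) / k - sin (k * 0) / k.
  apply: (Rintegral_derive (fun t => sin (k * t) / k)) => t.
    have H : is_derive t (1 : R) (k^-1 *: (sin \o (k *: id))) (cos (k * t)).
      by apply: is_derive_eq; rewrite /GRing.scale/=; field.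
    rewrite (_ : (fun t => _) = k^-1 *: (sin \o (k *: id)))//.
    by apply/funext => x /=; rewrite [RHS]mulrC.
  apply: (@continuous_comp _ _ _ (fun t : R => k * t) cos).
    exact: mulrl_continuous.
  exact: continuous_cos.
have -> : \int[mu]_(t in I01) sin (k * t) = - cos (k * 1) / k - - cos (k * 0) / k.
  apply: (Rintegral_derive (fun t => - cos (k * t) / k)) => t.
    have H : is_derive t (1 : R) (k^-1 *: (- (cos \o (k *: id)))) (sin (k * t)).
      by apply: is_derive_eq; rewrite /GRing.scale/=; field.
    rewrite (_ : (fun t => _) = k^-1 *: (- (cos \o (k *: id))))//.
    by apply/funext => x /=; rewrite [RHS]mulrC.
  apply: (@continuous_comp _ _ _ (fun t : R => k * t) sin).
    exact: mulrl_continuous.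
  exact: continuous_sin.
by rewrite !mulr1 !mulr0 ck sk sin0 cos0; apply: complexP => /=; ring.
Qed.

(** * L2 limits of polynomials and of Laurent polynomials *)

(** The L2 closure of [V], with an epsilon instead of sequences so that closing twice needs no
    diagonal extraction. *)
Definition approx (V : set (C -> C)) : set (C -> C) :=
  [set f | L2 f /\ forall e : R, 0 < e -> exists g, [/\ V g, L2 g & sqnorm (fun z => f z - g z) < e]].

Lemma L2B f g : L2 f -> L2 g -> L2 (fun z => f z - g z).
Proof. by move=> Lf /L2N; exact: L2D. Qed.

Lemma sqnorm_unit f g : (forall z, z * z^* = 1 -> Normc.normc (f z) = Normc.normc (g z)) ->
  sqnorm f = sqnorm g.
Proof.
by move=> fg; congr fine; apply: eq_integral => t _; rewrite fg// circ1.
Qed.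

Lemma sqnorm_eq f g : (forall z, z * z^* = 1 -> f z = g z) -> sqnorm f = sqnorm g.
Proof. by move=> fg; apply: sqnorm_unit => z z1; rewrite fg. Qed.

Lemma sqnormBC f g : sqnorm (fun z => f z - g z) = sqnorm (fun z => g z - f z).
Proof. by apply: sqnorm_unit => z _; rewrite -normcN opprB. Qed.

Lemma measT_eq f g : (forall z, z * z^* = 1 -> f z = g z) -> measT f -> measT g.
Proof.
move=> fg [f1 f2]; split; [rewrite (_ : (fun t => _) = (fun t => re (f (circ t))))// |
  rewrite (_ : (fun t => _) = (fun t => im (f (circ t))))//]; apply/funext => t;
  by rewrite fg ?circ1.
Qed.

Lemma eqT_unit f g : (forall z, z * z^* = 1 -> f z = g z) -> eqT f g.
Proof. by move=> fg; apply: aeW => t _; rewrite fg// circ1. Qed.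

Lemma L2_eq f g : (forall z, z * z^* = 1 -> f z = g z) -> L2 f -> L2 g.
Proof.
move=> fg Lf; apply: (L2_eqT f g Lf _ (eqT_unit f g fg)).
exact: measT_eq fg (L2_meas f Lf).
Qed.

Lemma approx_sub V f : V f -> L2 f -> approx V f.
Proof.
move=> Vf Lf; split => // e e0; exists f; split => //.
rewrite (sqnorm_eq _ (fun=> 0 * 0)); last by move=> z _; rewrite subrr mul0r.
by rewrite (sqnormZ 0 _ (L2_cst 0)) Normc.normc0 expr0n mul0r.
Qed.

Lemma approx_lim V f : L2 f ->
  (forall e : R, 0 < e -> exists g, approx V g /\ sqnorm (fun z => f z - g z) < e) -> approx V f.
Proof.
(* [sqnormD_le] costs a factor 2 and there are two errors, hence [e / 4]. *)
move=> Lf H; split => // e e0; have e4 : 0 < e / 4 by rewrite divr_gt0.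
have [g [[Lg Hg] fg]] := H _ e4; have [u [Vu Lu gu]] := Hg _ e4.
exists u; split => //.
rewrite (sqnorm_eq _ (fun z => (f z - g z) + (g z - u z))); last by move=> z _; ring.
by apply: le_lt_trans (sqnormD_le _ _ (L2B _ _ Lf Lg) (L2B _ _ Lg Lu)) _; lra.
Qed.

Lemma approx_lin V a f g : (forall f g, V f -> V g -> V (fun z => f z + a * g z)) ->
  approx V f -> approx V g -> approx V (fun z => f z + a * g z).
Proof.
move=> VD [Lf Hf] [Lg Hg]; split; first by apply/L2D/L2Z.
move=> e e0; have e4 : 0 < e / 4 by rewrite divr_gt0.
(* The added 1 keeps the divisor positive when [a = 0]. *)
have a0 : 0 < Normc.normc a ^+ 2 + 1 by rewrite ltr_wpDl// sqr_ge0.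
have [f1 [Vf1 Lf1 ff1]] := Hf _ e4.
have [g1 [Vg1 Lg1 gg1]] := Hg _ (divr_gt0 e4 a0).
exists (fun z => f1 z + a * g1 z); split; [exact: VD|by apply/L2D/L2Z|].
rewrite (sqnorm_eq _ (fun z => (f z - f1 z) + a * (g z - g1 z))); last by move=> z _; ring.
have LB := L2B _ _ Lg Lg1.
apply: le_lt_trans (sqnormD_le _ _ (L2B _ _ Lf Lf1) (L2Z a _ LB)) _.
rewrite sqnormZ//; move: gg1; rewrite ltr_pdivlMr//.
have := sqnorm_ge0 (fun z => g z - g1 z).
move: ff1; move: (sqnorm _) (sqnorm _) (Normc.normc a ^+ 2) => F G k *; nra.
Qed.

Lemma normcX z n : Normc.normc (z ^+ n) = Normc.normc z ^+ n.
Proof. by elim: n => [|n IH]; rewrite ?expr0 ?Normc.normc1// !exprS Normc.normcM IH. Qed.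

Lemma unit_normcX z n : z * z^* = 1 -> Normc.normc (z ^+ n) = 1.
Proof. by move=> z1; rewrite normcX normc_unit// expr1n. Qed.

Lemma unit_normcJX z n : z * z^* = 1 -> Normc.normc (z^* ^+ n) = 1.
Proof. by move=> z1; rewrite normcX normcJc normc_unit// expr1n. Qed.

Lemma L2_X n : L2 (fun z => z ^+ n).
Proof.
apply: (L2_eq (fun z => z ^+ n * 1)); first by move=> z _; rewrite mulr1.
apply: (L2Mb 1); [exact: L2_cst|exact: (measTX id n measT_id)|].
by move=> z z1; rewrite unit_normcX.
Qed.

Lemma L2_XM n f : L2 f -> L2 (fun z => z ^+ n * f z).
Proof.
move=> Lf; apply: (L2Mb 1) => //; first exact: L2_meas (L2_X n).
by move=> z z1; rewrite unit_normcX.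
Qed.

Lemma L2_JXM n f : L2 f -> L2 (fun z => z^* ^+ n * f z).
Proof.
move=> Lf; apply: (L2Mb 1) => //; first by apply/measTX/measTJ; exact: measT_id.
by move=> z z1; rewrite unit_normcJX.
Qed.

Lemma L2_JX n : L2 (fun z => z^* ^+ n).
Proof.
apply: L2_eq (L2_JXM n (fun=> 1) (L2_cst 1)).
by move=> z _; rewrite mulr1.
Qed.

Lemma L2_sum n (F : nat -> C -> C) : (forall i, L2 (F i)) -> L2 (fun z => \sum_(i < n) F i z).
Proof.
move=> LF; elim: n => [|n IH].
  by apply: L2_eq (L2_cst 0) => z _; rewrite big_ord0.
by apply: L2_eq (L2D _ _ IH (LF n)) => z _; rewrite big_ord_recr.
Qed.

Lemma ip_sum n (a : nat -> C) (F : nat -> C -> C) u : (forall i, L2 (F i)) -> L2 u ->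
  ip (fun z => \sum_(i < n) a i * F i z) u = \sum_(i < n) a i * ip (F i) u.
Proof.
move=> LF Lu; elim: n => [|n IH].
  rewrite big_ord0 /ip (meanT_eq _ (fun=> 0)) ?meanT_cst// => z _.
  by rewrite big_ord0 mul0r.
rewrite big_ord_recr /= -IH -ip_linl//; last first.
  by apply: (L2_sum n (fun i z => a i * F i z)) => i; exact: L2Z.
by apply: meanT_eq => z _; rewrite big_ord_recr.
Qed.

Lemma L2_horner p : L2 (fun z => p.[z]).
Proof.
apply: L2_eq (L2_sum (size p) (fun i z => p`_i * z ^+ i) _); last by move=> i; exact/L2Z/L2_X.
by move=> z _; rewrite horner_coef.
Qed.

Lemma ip_horner p u : L2 u ->
  ip (fun z => p.[z]) u = \sum_(i < size p) p`_i * ip (fun z => z ^+ i) u.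
Proof.
move=> Lu; rewrite -(ip_sum _ (fun i => p`_i) (fun i z => z ^+ i))//; last exact: L2_X.
by apply: meanT_eq => z _; rewrite horner_coef.
Qed.

Definition polyf : set (C -> C) :=
  [set f | exists p, forall z, z * z^* = 1 -> f z = p.[z]].

(** Laurent polynomials: on the circle [z^*] is the inverse of [z]. *)
Definition laurent : set (C -> C) :=
  [set f | exists n p, forall z, z * z^* = 1 -> f z = z^* ^+ n * p.[z]].

Local Notation trig := (approx laurent).

Lemma polyf_lin a f g : polyf f -> polyf g -> polyf (fun z => f z + a * g z).
Proof.
move=> [p fp] [q gq]; exists (p + a *: q) => z z1.
by rewrite hornerD hornerZ fp// gq.
Qed.

Lemma unitX z n : z * z^* = 1 -> z^* ^+ n * z ^+ n = 1.
Proof. by move=> z1; rewrite -exprMn mulrC z1 expr1n. Qed.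

Lemma laurent_lin a f g : laurent f -> laurent g -> laurent (fun z => f z + a * g z).
Proof.
move=> [n [p fp]] [m [q gq]]; exists (n + m)%N, ('X^m * p + a *: ('X^n * q)) => z z1.
rewrite fp// gq// hornerD hornerZ !hornerM !hornerXn exprD.
have := unitX z n z1; have := unitX z m z1.
set A := z ^+ n; set B := z ^+ m; set A' := _ ^+ n; set B' := _ ^+ m => B1 A1.
rewrite [RHS](_ : _ = A' * (B' * B) * p.[z] + a * (B' * (A' * A) * q.[z])); last by ring.
by rewrite B1 A1 !mulr1.
Qed.

Lemma ip_XX n m : ip (fun z => z ^+ n) (fun z => z ^+ m) = (n == m)%:R.
Proof.
have H k l : (k <= l)%N -> ip (fun z => z ^+ l) (fun z => z ^+ k) = (l == k)%:R.
  move=> kl; rewrite /ip (meanT_eq _ (fun z => z ^+ (l - k))).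
    by rewrite meanT_expr subn_eq0 eqn_leq kl andbT.
  move=> z z1; rewrite -{1}(subnK kl) exprD -mulrA rmorphXn/= [_ ^+ k * _]mulrC.
  by rewrite unitX// mulr1.
have [/H//|/ltnW/H] := leqP m n.
rewrite (ip_sym _ _ (L2_X n) (L2_X m)) => h.
by rewrite -[LHS]conjCK h eq_sym rmorph_nat.
Qed.

(** From right to left, the Taylor sum is a best approximation: once [N] reaches the size of [p],
    the error [f - S] is orthogonal to the polynomial [S - p], so [S] is at least as close to [f] as
    [p] is. *)
Lemma hardyP f : hardy f <-> approx polyf f.
Proof.
have E N z : (\poly_(i < N) fourier f i).[z] = \sum_(n < N) fourier f n * z ^+ n.
  by rewrite horner_poly.
split=> [[Lf cf]|[Lf cf]]; split=> //.
  move=> e e0; move/cvgrPdist_lt: cf => /(_ e e0)[N _ /(_ N (leqnn N))] /=.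
  rewrite sub0r normrN ger0_norm ?sqnorm_ge0// => lt.
  exists (fun z => (\poly_(i < N) fourier f i).[z]); split.
  - by exists (\poly_(i < N) fourier f i).
  - exact: L2_horner.
  - rewrite sqnormBC; apply: le_lt_trans lt; rewrite le_eqVlt; apply/orP; left; apply/eqP.
    by apply: sqnorm_eq => z _; rewrite E.
apply/cvgrPdist_lt => e e0; have [g [[p gp] Lg fg]] := cf e e0.
exists (size p) => // N /= Np.
rewrite sub0r normrN ger0_norm ?sqnorm_ge0//; apply: le_lt_trans fg.
rewrite sqnormBC.
set S := (fun z => \sum_(n < N) fourier f n * z ^+ n).
have LS : L2 S by apply: L2_eq (L2_horner (\poly_(i < N) fourier f i)) => z _; rewrite E.
have LfS := L2B _ _ Lf LS.
pose q := \poly_(i < N) fourier f i - p.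
rewrite (sqnorm_eq (fun z => f z - g z) (fun z => (f z - S z) + q.[z])); last first.
  by move=> z z1; rewrite gp// hornerD hornerN E -/(S z); ring.
rewrite (sqnormD _ _ LfS (L2_horner q)).
have -> : ip (fun z => f z - S z) (fun z => q.[z]) = 0.
  rewrite (ip_sym _ _ (L2_horner q) LfS) (ip_horner q _ LfS).
  rewrite big1 ?rmorph0// => i _.
  have iN : (i < N)%N.
    apply: leq_trans (ltn_ord i) _; apply: leq_trans (size_polyD _ _) _.
    by rewrite size_polyN geq_max Np andbT size_poly.
  rewrite (ip_sym _ _ LfS (L2_X i)) (ipBl _ _ _ Lf LS (L2_X i)).
  have -> : ip S (fun z => z ^+ i) = \sum_(j < N) fourier f j * ((j : nat) == i)%:R.
    rewrite [LHS](ip_sum N (fourier f) (fun n z => z ^+ n) _ L2_X (L2_X i)).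
    by apply: eq_bigr => j _; rewrite ip_XX.
  rewrite (bigD1 (Ordinal iN))//= eqxx mulr1 big1.
    by rewrite addr0 subrr rmorph0 mulr0.
  by move=> j ji; move: ji; rewrite -val_eqE /= => /negbTE ->; rewrite mulr0.
by rewrite mulr0 addr0 lerDl sqnorm_ge0.
Qed.

Lemma hardy_L2 f : hardy f -> L2 f. Proof. by case. Qed.

Lemma sqr_small_eq0 (x K : R) : (forall e : R, 0 < e -> x ^+ 2 <= K * e) -> x = 0.
Proof.
move=> H; apply/eqP; rewrite -sqrf_eq0 eq_le sqr_ge0 andbT leNgt; apply/negP => x0.
have K0 : 0 < `|K| + 1 by rewrite ltr_wpDl.
have := H _ (divr_gt0 x0 (mulr_gt0 (ltr0n R 2) K0)); rewrite leNgt => /negP; apply.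
rewrite mulrA ltr_pdivrMr ?mulr_gt0// -subr_gt0.
have := ler_norm K; have := normr_ge0 K; move: x0; move: (x ^+ 2) `|K| => *; nra.
Qed.

(** Linearity passes from monomials to polynomials, Cauchy-Schwarz to their limits. The pairing is
    bilinear; [u] is conjugated only to make it an [ip]. *)
Lemma meanT_mul_hardy u f : L2 u -> (forall n, meanT (fun z => u z * z ^+ n) = 0) ->
  hardy f -> meanT (fun z => u z * f z) = 0.
Proof.
move=> Lu u0 /hardyP[Lf Hf]; have LJ := L2J _ Lu.
apply: Normc.eq0_normc; apply: (sqr_small_eq0 _ (sqnorm (fun z => (u z)^*))) => e e0.
have [g [[p gp] Lg fg]] := Hf e e0.
have -> : meanT (fun z => u z * f z) = ip (fun z => f z - g z) (fun z => (u z)^*).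
  rewrite ipBl// [X in _ - X](_ : _ = 0).
    by rewrite subr0; apply: meanT_eq => z _; rewrite /= conjCK mulrC.
  transitivity (ip (fun z => p.[z]) (fun z => (u z)^*)).
    by apply: meanT_eq => z z1; rewrite gp.
  rewrite ip_horner// big1// => i _; rewrite [X in _ * X](_ : _ = 0) ?mulr0//.
  by rewrite -(u0 i); apply: meanT_eq => z _; rewrite /= conjCK mulrC.
apply: le_trans (cauchy_schwarz _ _ (L2B _ _ Lf Lg) LJ) _.
by rewrite mulrC ler_wpM2l ?sqnorm_ge0// ltW.
Qed.

(** The mean is the Fourier coefficient of index [-(n + 1)]. *)
Lemma hardy_meanT_expr f n : hardy f -> meanT (fun z => f z * z ^+ n.+1) = 0.
Proof.
move=> hf; rewrite -(meanT_mul_hardy (fun z => z ^+ n.+1) f (L2_X _) _ hf).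
  by apply: meanT_eq => z _; rewrite mulrC.
move=> m; rewrite -[RHS](meanT_expr (n.+1 + m)).
by apply: meanT_eq => z _; rewrite exprD.
Qed.

Lemma hardy_lin a f g : hardy f -> hardy g -> hardy (fun z => f z + a * g z).
Proof. by move=> /hardyP hf /hardyP hg; apply/hardyP/approx_lin => //; exact: polyf_lin. Qed.

Lemma trig_lin a f g : trig f -> trig g -> trig (fun z => f z + a * g z).
Proof. by move=> hf hg; apply/approx_lin => //; exact: laurent_lin. Qed.

Lemma approx_eq V f g : (forall z, z * z^* = 1 -> f z = g z) -> approx V f -> approx V g.
Proof.
move=> fg [Lf Hf]; split; first exact: L2_eq fg Lf.
move=> e /Hf[u [Vu Lu fu]]; exists u; split => //.
by rewrite -(sqnorm_eq (fun z => f z - u z))// => z z1; rewrite fg.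
Qed.

Lemma hardy_eq f g : (forall z, z * z^* = 1 -> f z = g z) -> hardy f -> hardy g.
Proof. by move=> fg /hardyP/(approx_eq _ _ _ fg)/hardyP. Qed.

Lemma hardy_X n : hardy (fun z => z ^+ n).
Proof.
apply/hardyP; apply: approx_sub; last exact: L2_X.
by exists 'X^n => z _; rewrite hornerXn.
Qed.

Lemma hardy_cst a : hardy (fun=> a).
Proof.
apply: (hardy_eq (fun z => 0 + a * z ^+ 0)); first by move=> z _; rewrite expr0 mulr1 add0r.
apply: hardy_lin; last exact: hardy_X.
apply/hardyP; apply: approx_sub; last exact: L2_cst.
by exists 0 => z _; rewrite horner0.
Qed.

Lemma hardy_XM n f : hardy f -> hardy (fun z => z ^+ n * f z).
Proof.
move=> /hardyP[Lf Hf]; apply/hardyP; split; first exact: L2_XM.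
move=> e /Hf[g [[p gp] Lg fg]]; exists (fun z => z ^+ n * g z); split.
- by exists ('X^n * p) => z z1; rewrite hornerM hornerXn gp.
- exact: L2_XM.
- rewrite (sqnorm_unit _ (fun z => f z - g z))// => z z1.
  by rewrite -mulrBr Normc.normcM unit_normcX// mul1r.
Qed.

Lemma hardy_trig n f : hardy f -> trig (fun z => z^* ^+ n * f z).
Proof.
move=> /hardyP[Lf Hf]; split; first exact: L2_JXM.
move=> e /Hf[g [[p gp] Lg fg]]; exists (fun z => z^* ^+ n * g z); split.
- by exists n, p => z z1; rewrite gp.
- exact: L2_JXM.
- rewrite (sqnorm_unit _ (fun z => f z - g z))// => z z1.
  by rewrite -mulrBr Normc.normcM unit_normcJX// mul1r.
Qed.

Lemma trig_sum n (a : nat -> C) (F : nat -> C -> C) : (forall i, trig (F i)) ->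
  trig (fun z => \sum_(i < n) a i * F i z).
Proof.
move=> tF; elim: n => [|n IH].
  apply: approx_eq (hardy_trig 0 _ (hardy_cst 0)) => z _.
  by rewrite big_ord0 mulr0.
by apply: approx_eq (trig_lin (a n) _ _ IH (tF n)) => z _; rewrite big_ord_recr.
Qed.

Lemma unitXB z n i : z * z^* = 1 -> (i <= n)%N -> z^* ^+ n * z ^+ i = z^* ^+ (n - i).
Proof. by move=> z1 le; rewrite -{1}(subnK le) exprD -mulrA unitX// mulr1. Qed.

(* Dropping the negative part of an approximating Laurent polynomial does not
   increase the distance to f; this avoids the completeness of the
   trigonometric system. *)
Lemma trig_hardy f : trig f -> (forall n, meanT (fun z => f z * z ^+ n.+1) = 0) -> hardy f.
Proof.
move=> [Lf Hf] f0; apply/hardyP; split => // e e0.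
have [g [[n [p gp]] Lg fg]] := Hf e e0.
(* The Laurent polynomial is [q] plus the negative powers [z^* ^+ n * r]. Neither [f] nor [q] has
   negative coefficients, so [f - q] is orthogonal to the second part. *)
set q := drop_poly n p; set r := take_poly n p.
exists (fun z => q.[z]); split; [by exists q|exact: L2_horner|].
apply: le_lt_trans fg.
have Lq := L2B _ _ Lf (L2_horner q).
have Lr := L2_JXM n _ (L2_horner r).
rewrite [leRHS](sqnorm_eq _ (fun z => (f z - q.[z]) - z^* ^+ n * r.[z])); last first.
  move=> z z1; rewrite gp// -{1}(poly_take_drop n p) hornerD hornerM hornerXn -/q -/r.
  by have := unitX z n z1; move: (_ ^+ n) (z ^+ n) => A B AB; ring: AB.
rewrite (sqnormB _ _ Lq Lr).
suff -> : ip (fun z => f z - q.[z]) (fun z => z^* ^+ n * r.[z]) = 0.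
  by rewrite mulr0 subr0 lerDl sqnorm_ge0.
rewrite (ip_sym _ _ Lr Lq).
suff -> : ip (fun z => z^* ^+ n * r.[z]) (fun z => f z - q.[z]) = 0 by rewrite rmorph0.
transitivity (ip (fun z => \sum_(i < size r) r`_i * z^* ^+ (n - i)) (fun z => f z - q.[z])).
  apply: meanT_eq => z z1; congr (_ * _); rewrite horner_coef mulr_sumr.
  apply: eq_bigr => i _; rewrite mulrCA unitXB//.
  by apply: ltnW; apply: leq_trans (ltn_ord i) (size_take_poly _ _).
rewrite (ip_sum _ (fun i => r`_i) (fun i z => z^* ^+ (n - i)) _ (fun i => L2_JX _) Lq).
apply: big1 => i _.
have iN : (i < n)%N by apply: leq_trans (ltn_ord i) (size_take_poly _ _).
rewrite (ip_sym _ _ Lq (L2_JX (n - i))) (ipBl _ _ _ Lf (L2_horner q) (L2_JX (n - i))).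
(* As [i < n], the exponent [n - i] is a successor, the form in which [f0] applies. *)
have E u : ip u (fun z => z^* ^+ (n - i)) = meanT (fun z => u z * z ^+ (n - i.+1).+1).
  apply: meanT_eq => z _; rewrite rmorphXn/= conjCK.
  by rewrite -(subSn iN) subSS.
rewrite !E f0 sub0r [X in (- X)^*](_ : _ = 0) ?oppr0 ?rmorph0 ?mulr0//.
transitivity (ip (fun z => q.[z]) (fun z => z^* ^+ (n - i))); first by rewrite E.
rewrite (ip_horner q _ (L2_JX (n - i))) big1// => j _.
by rewrite E (hardy_meanT_expr _ _ (hardy_X j)) mulr0.
Qed.

(** * Values in the disc *)

(** The geometric series in [w / z], with [z^*] for [1 / z]. Its exact remainder replaces any
    infinite sum of functions. *)
Lemma inv_geom w z n : `|w| < 1 -> z * z^* = 1 ->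
  (z - w)^-1 = \sum_(i < n) w ^+ i * z^* ^+ i.+1 + w ^+ n * (z^* ^+ n * (z - w)^-1).
Proof.
move=> w1 z1; have zw := unit_neq w z w1 z1.
elim: n => [|n IH]; first by rewrite big_ord0 add0r !expr0 !mul1r.
rewrite big_ord_recr /= {1}IH -addrA; congr (_ + _).
have EX : (z - w)^-1 = z^* + w * z^* * (z - w)^-1.
  apply: (mulfI zw); rewrite mulrDr mulrCA divff// mulr1 -[LHS]z1; ring.
by rewrite {1}EX !exprS; ring.
Qed.

Lemma normcB_ge (x y : C) : Normc.normc x - Normc.normc y <= Normc.normc (x - y).
Proof. by rewrite lerBlDr -{1}(subrK y x) le_normcD. Qed.

Lemma L2_div w f : `|w| < 1 -> L2 f -> L2 (fun z => f z / (z - w)).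
Proof.
move=> w1 Lf; apply: (L2_eq (fun z => (z - w)^-1 * f z)); first by move=> z _; rewrite mulrC.
apply: (L2Mb (1 - Normc.normc w)^-1) => //; first exact: measT_inv.
move=> z z1; have := normcB_ge z w; rewrite normc_unit// => le.
have := normC_lt1 w w1; rewrite -subr_gt0 => w0.
by rewrite Normc.normcV lef_pV2 ?posrE// (lt_le_trans w0 le).
Qed.

Lemma expr_near w (e : R) : `|w| < 1 -> 0 < e ->
  exists N, forall n, (N <= n)%N -> Normc.normc w ^+ n < e.
Proof.
move=> /normC_lt1 w1 e0.
have : `|Normc.normc w| < 1 by rewrite ger0_norm ?normc_ge0.
move=> /cvg_expr/cvgrPdist_lt/(_ e e0)[N _ H]; exists N => n /H /=.
by rewrite sub0r normrN ger0_norm ?exprn_ge0 ?normc_ge0.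
Qed.

Lemma expr_small w (K e : R) : `|w| < 1 -> 0 < e -> 0 <= K ->
  exists n, Normc.normc (w ^+ n) ^+ 2 * K < e.
Proof.
move=> w1 e0 K0; have K1 : 0 < K + 1 by rewrite ltr_wpDl.
have [n /(_ n (leqnn n)) H] := expr_near w _ w1 (divr_gt0 e0 K1); exists n; move: H.
have : Normc.normc w ^+ n <= 1 by rewrite exprn_ile1 ?normc_ge0// ltW// normC_lt1.
have : 0 <= Normc.normc w ^+ n by rewrite exprn_ge0 ?normc_ge0.
rewrite normcX; move: (_ ^+ n) => r r0 r1; rewrite ltr_pdivlMr// => re.
apply: le_lt_trans re; rewrite -subr_ge0.
rewrite (_ : _ - _ = r * (K * (1 - r)) + r); last by ring.
by rewrite addr_ge0 ?mulr_ge0 ?subr_ge0.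
Qed.

(** Truncating [inv_geom] after [n] terms leaves [w ^+ n * z^* ^+ n] times the quotient itself,
    whose norm shrinks like [|w| ^+ n]. *)
Lemma trig_div w f : `|w| < 1 -> hardy f -> trig (fun z => f z / (z - w)).
Proof.
move=> w1 hf; have Ld := L2_div w f w1 (hardy_L2 f hf).
apply: approx_lim => // e e0.
have [n ne] := expr_small w (sqnorm (fun z => f z / (z - w))) e w1 e0 (sqnorm_ge0 _).
exists (fun z => \sum_(i < n) w ^+ i * (z^* ^+ i.+1 * f z)); split.
  by apply: (trig_sum n (fun i => w ^+ i) (fun i z => z^* ^+ i.+1 * f z)) => i; exact: hardy_trig.
apply: le_lt_trans ne; rewrite -sqnormZ//.
rewrite (sqnorm_unit _ (fun z => w ^+ n * (f z / (z - w))))// => z z1.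
have -> : f z / (z - w) - \sum_(i < n) w ^+ i * (z^* ^+ i.+1 * f z) =
    z^* ^+ n * (w ^+ n * (f z / (z - w))).
  rewrite {1}(inv_geom w z n)//.
  have -> : \sum_(i < n) w ^+ i * (z^* ^+ i.+1 * f z) = (\sum_(i < n) w ^+ i * z^* ^+ i.+1) * f z.
    by rewrite mulr_suml; apply: eq_bigr => i _; rewrite mulrA.
  by ring.
by rewrite Normc.normcM unit_normcJX// mul1r.
Qed.

(** The Taylor sum is [f] paired with the truncated Szego kernel; what the truncation drops is the
    remainder of [inv_geom]. *)
Lemma cauchy_remainder w f n : `|w| < 1 -> L2 f ->
  meanT (fun z => f z * (z / (z - w))) - \sum_(i < n) fourier f i * w ^+ i =
  w ^+ n * ip (fun z => f z / (z - w)) (fun z => z ^+ n * z^*).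
Proof.
move=> w1 Lf; have Ld := L2_div w f w1 Lf.
have LE : L2 (fun z => z ^+ n * z^*) by apply: L2_XM; exact: (L2_JX 1).
have Ls : L2 (fun z => \sum_(i < n) (w^*) ^+ i * z ^+ i).
  by apply: (L2_sum n (fun i z => (w^*) ^+ i * z ^+ i)) => i; apply/L2Z/L2_X.
have -> : \sum_(i < n) fourier f i * w ^+ i = ip f (fun z => \sum_(i < n) (w^*) ^+ i * z ^+ i).
  rewrite (ip_sym _ _ Ls Lf) (ip_sum _ (fun i => (w^*) ^+ i) (fun i z => z ^+ i) _ L2_X Lf).
  rewrite rmorph_sum; apply: eq_bigr => i _ /=.
  by rewrite rmorphM rmorphXn /= conjCK mulrC /fourier (ip_sym _ _ (L2_X i) Lf).
rewrite -ipZl//; apply/eqP; rewrite subr_eq -meanTD; last 2 first.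
- by apply: intTM; [exact: L2Z|exact: L2J].
- by apply: intTM => //; exact: L2J.
apply/eqP/meanT_eq => z z1.
rewrite rmorphM rmorphXn rmorph_sum /= conjCK {1}(inv_geom w z n)//.
have -> : \sum_(i < n) ((w^* ^+ i) * z ^+ i)^* = z * \sum_(i < n) w ^+ i * z^* ^+ i.+1.
  rewrite mulr_sumr; apply: eq_bigr => i _; rewrite rmorphM !rmorphXn/= conjCK.
  by rewrite exprS mulrCA [z * _]mulrA z1 mul1r.
by ring.
Qed.

Lemma normc_ge_ReIm (x : C) : `|re x| <= Normc.normc x /\ `|im x| <= Normc.normc x.
Proof.
by split; rewrite -(@ler_sqr _ `|_|) ?nnegrE ?normc_ge0// normc_sqr real_normK ?num_real//
  ?lerDl ?lerDr ?sqr_ge0.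
Qed.

(** Cauchy's formula, with the remainder bounded by [|w| ^+ n * K] through Cauchy-Schwarz. For [f]
    outside H^2 it evaluates the analytic part of [f]; it is applied below to functions with only
    negative frequencies, where it gives 0. *)
Lemma disc_cauchy w f : `|w| < 1 -> L2 f -> disc f w = meanT (fun z => f z * (z / (z - w))).
Proof.
move=> w1 Lf; set L := meanT _; have Ld := L2_div w f w1 Lf.
pose S n := \sum_(i < n) fourier f i * w ^+ i.
pose K := Num.sqrt (sqnorm (fun z => f z / (z - w)) * sqnorm (fun=> 1 : C)).
have K0 : 0 <= K by exact: sqrtr_ge0.
have K1 : 0 < K + 1 by rewrite ltr_wpDl.
have D n : Normc.normc (L - S n) <= Normc.normc w ^+ n * K.
  rewrite cauchy_remainder// Normc.normcM normcX ler_wpM2l ?exprn_ge0 ?normc_ge0//.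
  have LE : L2 (fun z => z ^+ n * z^*) by apply: L2_XM; exact: (L2_JX 1).
  rewrite -(@ler_sqr _ (Normc.normc _)) ?nnegrE ?normc_ge0//.
  rewrite [K ^+ 2]sqr_sqrtr ?mulr_ge0 ?sqnorm_ge0//; apply: le_trans (cauchy_schwarz _ _ Ld LE) _.
  rewrite (sqnorm_unit (fun z => z ^+ n * z^*) (fun=> 1))// => z z1.
  by rewrite Normc.normcM unit_normcX// (unit_normcJX z 1)// Normc.normc1 mulr1.
have H e : 0 < e -> exists N, forall n, (N <= n)%N -> Normc.normc (L - S n) < e.
  move=> e0; have [N HN] := expr_near w _ w1 (divr_gt0 e0 K1); exists N => n /HN.
  rewrite ltr_pdivlMr//; apply: le_lt_trans; apply: le_trans (D n) _.
  by rewrite ler_wpM2l ?exprn_ge0 ?normc_ge0// lerDl.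
have cr : re (S n) @[n --> \oo] --> re L.
  apply/cvgrPdist_lt => e /H[N HN]; exists N => // n /HN; apply: le_lt_trans.
  by rewrite -ReN -ReD; case: (normc_ge_ReIm (L - S n)).
have ci : im (S n) @[n --> \oo] --> im L.
  apply/cvgrPdist_lt => e /H[N HN]; exists N => // n /HN; apply: le_lt_trans.
  by rewrite -ImN -ImD; case: (normc_ge_ReIm (L - S n)).
rewrite /disc; apply: complexP => /=; exact: cvg_lim.
Qed.

Lemma disc0 f : L2 f -> disc f 0 = meanT f.
Proof.
move=> Lf; rewrite disc_cauchy ?normr0//; apply: meanT_eq => z z1.
by rewrite subr0 divff ?mulr1// -(subr0 z) unit_neq ?normr0.
Qed.

Lemma hardy_fourier0 f : hardy f -> (forall n, fourier f n = 0) -> eqT f (fun=> 0).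
Proof.
move=> [Lf cf] f0; apply: sqnorm_eq0 => //.
have H : (fun n : nat => sqnorm (fun z => \sum_(i < n) fourier f i * z ^+ i - f z)) = fun=> sqnorm f.
  apply/funext => n; apply: sqnorm_unit => z _.
  by rewrite big1 ?sub0r ?normcN// => i _; rewrite f0 mul0r.
move: cf; rewrite /L2_cvg H => cf.
by have := cvg_unique _ cf (cvg_cst (sqnorm f)) => <-.
Qed.

(** * Model spaces *)

Lemma eqT_sym f g : eqT f g -> eqT g f.
Proof. by apply: aeS => t fg It; rewrite fg. Qed.

Lemma eqT_trans f g u : eqT f g -> eqT g u -> eqT f u.
Proof. by apply: aeS2 => t fg gu It; rewrite fg// gu. Qed.

Lemma eqTM f g u : eqT f g -> eqT (fun z => u z * f z) (fun z => u z * g z).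
Proof. by apply: aeS => t fg It; rewrite fg. Qed.

Lemma ip_eqT f f' g g' : L2 f -> L2 f' -> L2 g -> L2 g' -> eqT f f' -> eqT g g' ->
  ip f g = ip f' g'.
Proof.
move=> Lf Lf' Lg Lg' ff' gg'; apply: meanT_eqT.
- by apply: measTM; [exact: L2_meas|exact/measTJ/L2_meas].
- by apply: measTM; [exact: L2_meas|exact/measTJ/L2_meas].
- by apply: aeS2 ff' gg' => t fE gE It; rewrite fE// gE.
Qed.

Lemma disc_fourier0 w f : (forall n, fourier f n = 0) -> disc f w = 0.
Proof.
move=> f0.
have E N : \sum_(n < N) fourier f n * w ^+ n = 0.
  by apply: big1 => i _; rewrite f0 mul0r.
by apply: complexP; rewrite /disc /=;
  rewrite (_ : (fun N => _) = fun=> 0) ?lim_cst//; apply/funext => N; rewrite E.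
Qed.

Lemma L2_intT f : L2 f -> intT f.
Proof.
move=> Lf; rewrite (_ : f = fun z => f z * 1); first exact: intTM Lf (L2_cst 1).
by apply/funext => z; rewrite mulr1.
Qed.

(** Split off 1 from [z / (z - w)]: what remains is [w] times the Cauchy integral of [z^*], which
    has no coefficient of nonnegative index. *)
Lemma meanT_cauchy_kernel w : `|w| < 1 -> meanT (fun z => z / (z - w)) = 1.
Proof.
move=> w1; have L1 : L2 (fun z => z^*) by exact: (L2_JX 1).
have L3 : L2 (fun z => z / (z - w)) by apply: L2_div => //; exact: (L2_X 1).
have I1 : intT (fun=> 1) := L2_intT _ (L2_cst 1).
have I2 : intT (fun z => z^* * (z / (z - w))) by exact: intTM.
rewrite (meanT_eq _ (fun z => 1 + w * (z^* * (z / (z - w))))).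
  rewrite meanTD//; last exact: intTZ.
  rewrite meanT_cst meanTZ// -disc_cauchy// disc_fourier0 ?mulr0 ?addr0// => n.
  rewrite /fourier (ip_sym _ _ (L2_X n) L1).
  rewrite [ip _ _](_ : _ = 0) ?rmorph0// -[RHS](meanT_expr n.+1).
  by apply: meanT_eq => z z1; rewrite conjCK exprS mulrC.
move=> z z1; have zw := unit_neq w z w1 z1.
have -> : 1 = (z - w) / (z - w) by rewrite divff.
have -> : w * (z^* * (z / (z - w))) = (z * z^*) * (w / (z - w)) by ring.
by rewrite z1; ring.
Qed.

Section Inner.
Context (theta : C -> C) (hi : inner_fun theta).

Lemma inner_hardy : hardy theta. Proof. by case: hi. Qed.
Let Lt : L2 theta. Proof. by case: hi => -[]. Qed.
Let mt : measT theta. Proof. exact: L2_meas. Qed.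

Lemma inner_unimod : eqT (fun z => theta z * (theta z)^*) (fun=> 1).
Proof. by case: hi => _ _ /unimodT. Qed.

Lemma L2_inner f : L2 f -> L2 (fun z => theta z * f z).
Proof. by move=> Lf; apply: L2_unimod => //; case: hi. Qed.

Lemma meanT_inner f : measT f -> meanT (fun z => theta z * (theta z)^* * f z) = meanT f.
Proof.
move=> mf; apply: meanT_eqT => //.
  by apply: measTM => //; apply: measTM => //; exact: measTJ.
by apply: aeS inner_unimod => t tE It; rewrite tE ?mul1r.
Qed.

Lemma ip_inner f g : L2 f -> L2 g ->
  ip (fun z => theta z * f z) (fun z => theta z * g z) = ip f g.
Proof.
move=> Lf Lg; rewrite /ip -[RHS]meanT_inner.
  by apply: meanT_eq => z _; rewrite rmorphM /=; ring.
by apply: measTM; [exact: L2_meas|exact/measTJ/L2_meas].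
Qed.

Lemma ip_innerX n : ip theta (fun z => theta z * z ^+ n) = (n == 0)%:R.
Proof.
rewrite eq_sym -(ip_XX 0 n).
rewrite -(ip_inner _ _ (L2_X 0) (L2_X n)).
by apply: meanT_eq => z _; rewrite expr0 mulr1.
Qed.

(** Orthogonality to the monomial multiples of [theta] extends to all of [theta H^2] by
    [meanT_mul_hardy] with [u = theta conj(g)]. *)
Lemma Kspace_intro g : hardy g -> (forall n, ip g (fun z => theta z * z ^+ n) = 0) ->
  Kspace theta g.
Proof.
move=> hg g0; split => // f hf; have Lg := hardy_L2 _ hg; have Lf := hardy_L2 _ hf.
have Lu : L2 (fun z => theta z * (g z)^*) by apply/L2_inner/L2J.
have E u : L2 u -> ip g (fun z => theta z * u z) = (meanT (fun z => theta z * (g z)^* * u z))^*.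
  move=> LU; rewrite -meanTJ; last exact: intTM.
  by apply: meanT_eq => z _; rewrite !rmorphM /= conjCK; ring.
rewrite E// (meanT_mul_hardy _ _ Lu _ hf) ?rmorph0// => n.
by apply: (can_inj conjCK); rewrite rmorph0 -E ?g0//; exact: L2_X.
Qed.

Lemma Kspace_L2 g : Kspace theta g -> L2 g. Proof. by case=> /hardy_L2. Qed.

Lemma Kspace_X g n : Kspace theta g -> ip g (fun z => theta z * z ^+ n) = 0.
Proof. by case=> _; apply; exact: hardy_X. Qed.

Lemma Kspace_lin a f g : Kspace theta f -> Kspace theta g ->
  Kspace theta (fun z => f z + a * g z).
Proof.
move=> [hf f0] [hg g0]; split; first exact: hardy_lin.
move=> u hu; have Lu := L2_inner _ (hardy_L2 _ hu).
by rewrite (ip_linl a _ _ _ (hardy_L2 _ hf) (hardy_L2 _ hg) Lu) f0// g0// mulr0 addr0.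
Qed.

(** The pairing with [theta z^n] is the conjugate of a mean that vanishes for [n > 0] since [theta]
    is in H^2, and for [n = 0] since [theta(0) = 0]. *)
Lemma Kspace1 : disc theta 0 = 0 -> Kspace theta (fun=> 1).
Proof.
move=> t0; apply: Kspace_intro; first exact: hardy_cst.
move=> n; rewrite (ip_sym _ _ (L2_inner _ (L2_X n)) (L2_cst 1)).
rewrite [ip _ _](_ : _ = 0) ?rmorph0//.
case: n => [|n]; last first.
  rewrite -[RHS](hardy_meanT_expr theta n inner_hardy).
  by apply: meanT_eq => z _; rewrite rmorph1 mulr1.
rewrite -t0 disc0//; apply: meanT_eq => z _.
by rewrite expr0 rmorph1 !mulr1.
Qed.

Lemma ip_theta0 f : ip f theta = ip f (fun z => theta z * z ^+ 0).
Proof. by apply: meanT_eq => z _; rewrite mulr1. Qed.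

(** Pairing [z g] with [theta z^(n+1)] cancels one [z] and falls back on [g]; only the pairing with
    [theta] itself can survive, and subtracting [c theta] removes it. *)
Lemma Kspace_shift g : Kspace theta g ->
  Kspace theta (fun z => z * g z - ip (fun z => z * g z) theta * theta z).
Proof.
move=> Kg; have Lg := Kspace_L2 _ Kg; have [hg _] := Kg.
have Lzg := L2_XM 1 _ Lg; have hzg := hardy_XM 1 _ hg.
set c := ip _ _; apply: Kspace_intro.
  apply: hardy_eq (hardy_lin (- c) _ _ hzg inner_hardy) => z _.
  by rewrite expr1 mulNr.
move=> n; have Ln := L2_inner _ (L2_X n).
transitivity (ip (fun z => z ^+ 1 * g z + (- c) * theta z) (fun z => theta z * z ^+ n)).
  by apply: meanT_eq => z _; rewrite expr1 mulNr.
rewrite (ip_linl _ _ _ _ Lzg Lt Ln) ip_innerX; case: n Ln => [|n] Ln.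
  by rewrite -ip_theta0 mulr1 subrr.
rewrite mulr0 addr0 -[RHS](Kspace_X g n Kg); apply: meanT_eq => z z1.
rewrite !rmorphM !rmorphXn /= expr1 exprS.
transitivity ((z * z^*) * (g z * ((theta z)^* * z^* ^+ n))); first by ring.
by rewrite z1 mul1r.
Qed.

(** On the circle this is the conjugation applied to [k / z]. It exchanges the two conditions:
    negative coefficients become conjugate pairings of [k] with [theta z^(n+1)], and pairings with
    [theta z^n] become conjugate means of [k z^n], where [n = 0] needs [k(0) = 0]. *)
Lemma Kspace_conj k : Kspace theta k -> meanT k = 0 ->
  Kspace theta (fun z => theta z * (k z)^*).
Proof.
move=> Kk k0; have [hk _] := Kk; have Lk := Kspace_L2 _ Kk.
have Ltk := L2_inner _ (L2J _ Lk).
apply: Kspace_intro.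
  apply: trig_hardy; last first.
    move=> n; apply: (can_inj conjCK); rewrite rmorph0 -(Kspace_X k n.+1 Kk).
    rewrite -meanTJ; last by apply: intTM => //; exact: L2_X.
    by apply: meanT_eq => z _; rewrite !rmorphM /= conjCK; ring.
  (* For a polynomial in place of [k] the product is a finite sum of terms [z^* ^+ i * theta]; since
     [|theta| = 1] almost everywhere, multiplying by it does not increase the error. *)
  apply: approx_lim => // e e0.
  have /hardyP[_ /(_ e e0)[g [[p gp] Lg kg]]] := hk.
  exists (fun z => theta z * (g z)^*); split.
    apply: (approx_eq _ (fun z => \sum_(i < size p) (p`_i)^* * (z^* ^+ i * theta z))).
      move=> z z1; rewrite gp// horner_coef rmorph_sum mulr_sumr.
      by apply: eq_bigr => i _; rewrite rmorphM rmorphXn /=; ring.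
    apply: (trig_sum _ (fun i => (p`_i)^*) (fun i z => z^* ^+ i * theta z)) => i.
    by apply: hardy_trig; exact: inner_hardy.
  apply: le_lt_trans kg; have Lkg := L2B _ _ Lk Lg.
  have LJ := L2J _ Lkg.
  rewrite (sqnorm_eq _ (fun z => theta z * (k z - g z)^*)); last first.
    by move=> z _; rewrite rmorphB mulrBr.
  have [//|_] := L2_dom 1 (fun z => k z - g z) (fun z => theta z * (k z - g z)^*)
    (L2_meas _ (L2_inner _ LJ)) Lkg _.
    apply: aeS inner_unimod => t tE It; rewrite Normc.normcM normcJc mul1r.
    by rewrite (normc_unit (theta (circ t))) ?mul1r ?tE.
  by rewrite expr1n mul1r.
move=> n; rewrite (ip_inner _ _ (L2J _ Lk) (L2_X n)).
transitivity (meanT (fun z => k z * z ^+ n))^*.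
  rewrite -meanTJ; last by apply: intTM => //; exact: L2_X.
  by apply: meanT_eq => z _; rewrite !rmorphM.
case: n => [|n]; last by rewrite hardy_meanT_expr// rmorph0.
by rewrite -[RHS](rmorph0 (@Num.conj C)) -k0; congr (_^*); apply: meanT_eq => z _; rewrite mulr1.
Qed.

End Inner.

(** * The compressed shift on h K_theta *)

Section Main.
Context (M : set (C -> C)) (h theta : C -> C).
Context (hM : nearly_invariant M) (hMh : hitt M h theta).

Let hi : inner_fun theta. Proof. by case: hMh. Qed.
Let t0 : disc theta 0 = 0. Proof. by case: hMh. Qed.
Let ME : M = mulK h theta. Proof. by case: hMh. Qed.
Let iso g : Kspace theta g ->
  M (fun z => h z * g z) /\ sqnorm (fun z => h z * g z) = sqnorm g.
Proof. by case: hMh => _ _ _ _; apply. Qed.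
Let ML2 f : M f -> L2 f. Proof. by case: hM => -[H _ _ _ _] _ _; exact: H. Qed.
Let Mhardy f : M f -> hardy f. Proof. by case: hM => _ H _; exact: H. Qed.
Let Mlin a f g : M f -> M g -> M (fun z => a * f z + g z).
Proof. by case: hM => -[_ _ H _ _] _ _; exact: H. Qed.
Let Meq f g : M f -> L2 g -> eqT f g -> M g.
Proof. by case: hM => -[_ _ _ H _] _ _; exact: H. Qed.
Let Lh : L2 h. Proof. by apply: ML2; case: hMh => -[]. Qed.
Let K1 : Kspace theta (fun=> 1). Proof. exact: Kspace1. Qed.
Let Lt : L2 theta. Proof. exact: hardy_L2 (inner_hardy _ hi). Qed.
Let Lth : L2 (fun z => theta z * h z). Proof. exact: L2_inner. Qed.

Lemma M_sub f g : M f -> M g -> M (fun z => f z - g z).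
Proof.
move=> Mf Mg; rewrite (_ : (fun z => _) = (fun z => -1 * g z + f z)); first exact: Mlin.
by apply/funext => z; rewrite mulN1r addrC.
Qed.

(** Polarization: equality of norms for [f + a g] gives the real parts with [a = 1] and the
    imaginary parts with [a = 'i]. *)
Lemma ip_mul_extremal f g : Kspace theta f -> Kspace theta g ->
  ip (fun z => h z * f z) (fun z => h z * g z) = ip f g.
Proof.
move=> Kf Kg; have [Mf Nf] := iso _ Kf; have [Mg Ng] := iso _ Kg.
have Lf := Kspace_L2 _ _ Kf; have Lg := Kspace_L2 _ _ Kg.
have E a : re (a^* * ip (fun z => h z * f z) (fun z => h z * g z)) = re (a^* * ip f g).
  have [_] := iso _ (Kspace_lin _ hi a _ _ Kf Kg).
  rewrite (sqnorm_eq _ (fun z => h z * f z + a * (h z * g z))); last by move=> z _; ring.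
  rewrite (sqnorm_lin _ _ _ (ML2 _ Mf) (ML2 _ Mg)) (sqnorm_lin _ _ _ Lf Lg) Nf Ng.
  by move=> /addrI H; lra.
apply: complexP; first by have := E 1; rewrite rmorph1 !mul1r.
have := E 'i%C; rewrite !(ReM, ReJ, ImJ) /=; lra.
Qed.

Let v := meanT (fun z => theta z * `|h z| ^+ 2).

Lemma v_ip : v = ip (fun z => theta z * h z) h.
Proof. by apply: meanT_eq => z _; rewrite sqr_normc mulrA. Qed.

Lemma ip_theta_extremal k : Kspace theta k ->
  ip (fun z => theta z * h z - v * h z) (fun z => h z * k z) = 0.
Proof.
move=> Kk; have [Mk _] := iso _ Kk; have Lk := Kspace_L2 _ _ Kk; have Lhk := ML2 _ Mk.
(* [m] is [k(0)]. Removing it reduces to the case [k(0) = 0], settled in [E1]; the constant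
   contributes [conj(m) v] to [E2], which cancels against [v] times [E3]. *)
pose m := meanT k.
have Kk0 : Kspace theta (fun z => k z + - m * 1) by exact: Kspace_lin.
have m0 : meanT (fun z => k z + - m * 1) = 0.
  rewrite meanTD; [|exact: L2_intT|exact: (L2_intT _ (L2_cst _))].
  by rewrite meanT_cst mulr1 subrr.
have Kc := Kspace_conj _ hi _ Kk0 m0.
have [Mk0 _] := iso _ Kk0.
have E1 : ip (fun z => theta z * h z) (fun z => h z * (k z + - m * 1)) = 0.
  transitivity (ip (fun z => h z * (theta z * (k z + - m * 1)^*)) (fun z => h z * 1)).
    by apply: meanT_eq => z _; rewrite !rmorphM /= rmorph1; ring.
  rewrite (ip_mul_extremal _ _ Kc K1).
  transitivity (ip (fun z => k z + - m * 1) (fun z => theta z * z ^+ 0))^*.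
    rewrite -(ip_sym _ _ (Kspace_L2 _ _ Kk0) (L2_inner _ hi _ (L2_X 0))).
    by apply: meanT_eq => z _; rewrite expr0 rmorph1 !mulr1.
  by rewrite (Kspace_X _ _ _ Kk0) rmorph0.
have E2 : ip (fun z => theta z * h z) (fun z => h z * k z) = m^* * v.
  transitivity (ip (fun z => theta z * h z) (fun z => h z * (k z + - m * 1) + m * h z)).
    by apply: meanT_eq => z _; congr (_ * _^*); ring.
  by rewrite (ip_linr _ _ _ _ (ML2 _ Mk0) Lh Lth) E1 add0r -v_ip.
have E3 : ip h (fun z => h z * k z) = m^*.
  transitivity (ip (fun z => h z * 1) (fun z => h z * k z)).
    by apply: meanT_eq => z _; rewrite mulr1.
  rewrite (ip_mul_extremal _ _ K1 Kk) -meanTJ; last exact: L2_intT.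
  by apply: meanT_eq => z _; rewrite mul1r.
transitivity (ip (fun z => theta z * h z + - v * h z) (fun z => h z * k z)).
  by apply: meanT_eq => z _; ring.
by rewrite (ip_linl _ _ _ _ Lth Lh Lhk) E2 E3; ring.
Qed.

(** The factor of [h] in the compression of [z h g]: [c theta] is traded for [c v]. The final [* 1]
    exhibits the constant function as an element of K_theta. *)
Let shiftK g := fun z => z * g z - ip (fun z => z * g z) theta * theta z +
  ip (fun z => z * g z) theta * v * 1.

Lemma Kspace_shiftK g : Kspace theta g -> Kspace theta (shiftK g).
Proof. by move=> Kg; apply: Kspace_lin => //; exact: Kspace_shift. Qed.

Lemma L2_shift f : L2 f -> L2 (fun z => z * f z).
Proof. exact: (L2_XM 1). Qed.

(** [proj] is a choice operator: the explicit [p] shows that a projection exists, so the chosen one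
    has the defining property too. The two agree almost everywhere because their difference lies in
    [M] and is orthogonal to itself. *)
Lemma compressed_shiftP f g : M f -> Kspace theta g -> eqT f (fun z => h z * g z) ->
  [/\ M (compressed_shift M f),
      forall u, M u -> ip (fun z => z * f z - compressed_shift M f z) u = 0 &
      eqT (compressed_shift M f) (fun z => h z * shiftK g z)].
Proof.
move=> Mf Kg fg; have Kc := Kspace_shiftK _ Kg; have [Mp _] := iso _ Kc.
have [Mhg _] := iso _ Kg.
set p := (fun z => h z * shiftK g z) in Mp *.
have Lf := ML2 _ Mf; have Lzf := L2_shift _ Lf; have Lp := ML2 _ Mp.
have Hp u : M u -> ip (fun z => z * f z - p z) u = 0.
  move=> Mu; have Lu := ML2 _ Mu; have : M u by [].
  rewrite {1}ME => -[_ [k [Kk uk]]]; have [Mhk _] := iso _ Kk; have Lhk := ML2 _ Mhk.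
  pose c := ip (fun z => z * g z) theta.
  have LR : L2 (fun z => theta z * h z - v * h z) by apply: L2B => //; exact: L2Z.
  rewrite (ip_eqT _ (fun z => c * (theta z * h z - v * h z)) _ _ (L2B _ _ Lzf Lp) (L2Z c _ LR) Lu Lhk _ uk).
    by rewrite (ipZl _ _ _ LR Lhk) (ip_theta_extremal _ Kk) mulr0.
  by apply: aeS fg => t ft It; rewrite ft// /p /shiftK -/c; ring.
have [MP HP] : M (compressed_shift M f) /\
    forall u, M u -> ip (fun z => z * f z - compressed_shift M f z) u = 0.
  have : exists r, (M r /\ forall u, M u -> ip (fun z => Defs.shift f z - r z) u = 0) by exists p.
  exact: xgetPex.
split=> //; have LP := ML2 _ MP; have Md := M_sub _ _ MP Mp; have Ld := ML2 _ Md.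
have d0 : sqnorm (fun z => compressed_shift M f z - p z) = 0.
  apply: complexI; rewrite -ip_sqnorm -[RHS](subrr (0 : C)).
  rewrite -{1}(Hp _ Md) -(HP _ Md) -ipBl//; try exact: L2B.
  by apply: meanT_eq => z _; ring.
by apply: aeS (sqnorm_eq0 _ Ld d0) => t H It; apply/eqP; rewrite -subr_eq0 H.
Qed.

(** The isometry cancels [h] without dividing by it. *)
Lemma Kspace_eqT0 g : Kspace theta g -> eqT (fun z => h z * g z) (fun=> 0) ->
  eqT g (fun=> 0).
Proof.
move=> Kg hg0; have [Mg Ng] := iso _ Kg; apply: sqnorm_eq0; first exact: Kspace_L2 Kg.
rewrite -Ng (sqnorm_eqT _ _ (ML2 _ Mg) (measT_cst 0) hg0).
rewrite (sqnorm_eq _ (fun=> 0 * 0)); last by move=> z _; rewrite mul0r.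
by rewrite (sqnormZ 0 _ (L2_cst 0)) Normc.normc0 expr0n mul0r.
Qed.

(* |z f - w f|^2 = (1 - |w|^2) |f|^2 because w f is the projection of z f. *)
Lemma eigen_lt1 w f : eigenvector M w f -> `|w| < 1.
Proof.
move=> [Mf f0 Pf]; have Lf := ML2 _ Mf; have Lzf := L2_shift _ Lf.
have : M f by []. rewrite {1}ME => -[_ [g [Kg fg]]].
have [MP HP _] := compressed_shiftP _ _ Mf Kg fg; have LP := ML2 _ MP.
have Lwf := L2Z w _ Lf.
have n0 : 0 < sqnorm f.
  by rewrite lt_def sqnorm_ge0 andbT; apply/eqP => /(sqnorm_eq0 _ Lf).
have E : ip (fun z => z * f z) f = w * (sqnorm f)%:C.
  apply/eqP; rewrite -subr_eq0 -(HP _ Mf) ipBl// eq_sym; apply/eqP; congr (_ - _).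
  by rewrite (ip_eqT _ (fun z => w * f z) _ f LP Lwf Lf Lf Pf (eqT_refl f)) ipZl// ip_sqnorm.
have N : sqnorm (fun z => z * f z + (- w) * f z) = (1 - Normc.normc w ^+ 2) * sqnorm f.
  rewrite sqnorm_lin// E (sqnorm_unit (fun z => z * f z) f).
    by rewrite !normc_sqr !(ReM, ImM, ReJ, ImJ, ReN, ImN) /=; ring.
  by move=> z z1; rewrite Normc.normcM normc_unit// mul1r.
have w1 : Normc.normc w ^+ 2 <= 1.
  have := sqnorm_ge0 (fun z => z * f z + (- w) * f z).
  by rewrite N pmulr_lge0// subr_ge0.
suff : Normc.normc w ^+ 2 != 1.
  move=> w2; have : Normc.normc w ^+ 2 < 1 by rewrite lt_neqAle w2.
  by rewrite -[X in _ < X](expr1n _ 2) ltr_sqr ?nnegrE ?normc_ge0// -ltcR.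
apply/eqP => w2; apply: f0; apply: (hardy_fourier0 _ (Mhardy _ Mf)).
have zw : eqT (fun z => z * f z) (fun z => w * f z).
  have : sqnorm (fun z => z * f z + (- w) * f z) = 0 by rewrite N w2 subrr mul0r.
  move/(sqnorm_eq0 _ (L2D _ _ Lzf (L2Z _ _ Lf))); apply: aeS => t H It.
  by apply/eqP; rewrite -subr_eq0 -mulNr H.
have w0 : w != 0.
  by apply: contra_eq_neq w2 => ->; rewrite Normc.normc0 expr0n /= eq_sym oner_eq0.
have F n : ip (fun z => z * f z) (fun z => z ^+ n) = w * fourier f n.
  rewrite -ipZl//; last exact: L2_X.
  exact: (ip_eqT _ _ _ _ Lzf Lwf (L2_X n) (L2_X n) zw (eqT_refl _)).
(* Against [z^(n+1)], [z f] has the coefficient of [f] at [n], and against 1 it has 0; since [w] is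
   nonzero, each coefficient of [f] inherits the vanishing of the previous one. *)
elim=> [|n IH]; apply: (mulfI w0); rewrite mulr0 -F.
  rewrite -[RHS](hardy_meanT_expr f 0 (Mhardy _ Mf)); apply: meanT_eq => z _.
  by rewrite expr0 rmorph1 mulr1 expr1 mulrC.
rewrite -[RHS]IH; apply: meanT_eq => z z1; rewrite exprS rmorphM /=.
by rewrite mulrACA z1 mul1r.
Qed.

(** Cancelling [h] leaves an equation in K_theta; as [|w| < 1], it can be divided by [z - w] on the
    whole circle. The only freedom left is the scalar [c], so eigenspaces are lines. *)
Lemma eigen_eq w f g : eigenvector M w f -> Kspace theta g ->
  eqT f (fun z => h z * g z) ->
  let c := ip (fun z => z * g z) theta in
  eqT g (fun z => c * ((theta z - v) / (z - w))).
Proof.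
move=> ef Kg fg c; have w1 := eigen_lt1 _ _ ef; case: ef => Mf f0 Pf.
have [MP _ PE] := compressed_shiftP _ _ Mf Kg fg.
have Kd : Kspace theta (fun z => shiftK g z + - w * g z).
  by apply: Kspace_lin => //; exact: Kspace_shiftK.
have : eqT (fun z => h z * (shiftK g z + - w * g z)) (fun=> 0).
  have wf : eqT (fun z => h z * shiftK g z) (fun z => w * f z) := eqT_trans _ _ _ (eqT_sym _ _ PE) Pf.
  apply: aeS2 wf fg => t H ft It; rewrite mulrDr H// ft//; ring.
move/(Kspace_eqT0 _ Kd); apply: aeS => t H It.
have zw := unit_neq w _ w1 (circ1 t).
have := H It; rewrite /shiftK -/c => {}H.
apply: (mulIf zw); rewrite mulrA divfK//.
by apply/eqP; rewrite -subr_eq0 -[X in _ == X]H; apply/eqP; ring.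
Qed.

(** The mean of [g z] is 0 because [g] is in H^2, while Cauchy's formula evaluates it as
    [c (theta(w) - v)]; and [c = 0] would make [f] vanish. *)
Lemma eigen_value w f : eigenvector M w f -> disc theta w = v.
Proof.
move=> ef; have w1 := eigen_lt1 _ _ ef; have [Mf f0 _] := ef.
have : M f by []. rewrite {1}ME => -[_ [g [Kg fg]]].
have gE := eigen_eq _ _ _ ef Kg fg; set c := ip _ _ in gE.
have hg : hardy g by case: Kg.
have c0 : c != 0.
  apply/eqP => c0; apply: f0; apply: aeS2 fg gE => t fE gE It.
  by rewrite fE// gE// c0 mul0r mulr0.
have Lg := Kspace_L2 _ _ Kg; have L3 : L2 (fun z => z / (z - w)) by apply: L2_div => //; exact: (L2_X 1).
have Ltv := L2B _ _ Lt (L2_cst v).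
apply/eqP; rewrite -subr_eq0; apply/eqP/(mulfI c0); rewrite mulr0.
transitivity (meanT (fun z => c * ((theta z - v) * (z / (z - w))))).
  rewrite meanTZ; last exact: intTM.
  congr (_ * _); rewrite disc_cauchy//.
  rewrite -[in LHS](mulr1 v) -(meanT_cauchy_kernel w w1) -mulNr -meanTZ; last exact: L2_intT.
  rewrite -meanTD; [|exact: intTM|by apply/intTZ/L2_intT].
  by apply: meanT_eq => z _; ring.
rewrite -[RHS](hardy_meanT_expr g 0 hg); apply: meanT_eqT.
- by apply: measTM; [exact: measT_cst|apply: measTM; exact: L2_meas].
- by apply: measTM; [exact: L2_meas|exact: L2_meas (L2_X 1)].
- by apply: aeS gE => t gE It; rewrite gE// expr1; ring.
Qed.

(** The coefficient of index -1 is [theta(w) - v = 0]. Multiplying by [z - w] gives an H^2 function,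
    so each further negative coefficient is [w] times the preceding one. *)
Lemma div_theta_Kspace w : `|w| < 1 -> disc theta w = v ->
  Kspace theta (fun z => (theta z - v) / (z - w)).
Proof.
move=> w1 wv; set g := (fun z => _).
have htv : hardy (fun z => theta z - v).
  apply: hardy_eq (hardy_lin (- v) _ _ (inner_hardy _ hi) (hardy_cst 1)) => z _.
  by rewrite mulr1.
have Ltv := hardy_L2 _ htv; have Lg := L2_div _ _ w1 Ltv : L2 g.
have Li : L2 (fun z => z / (z - w)) by apply: L2_div => //; exact: (L2_X 1).
apply: (Kspace_intro _ hi).
  apply: trig_hardy; first exact: trig_div.
  elim=> [|n IH].
    transitivity (meanT (fun z => theta z * (z / (z - w)) + - v * (z / (z - w)))).
      by apply: meanT_eq => z _; rewrite /g expr1; ring.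
    rewrite meanTD; [|exact: intTM|by apply/intTZ/L2_intT].
    rewrite meanTZ; last exact: L2_intT.
    by rewrite -disc_cauchy// wv meanT_cauchy_kernel// mulr1 subrr.
  transitivity (meanT (fun z => (theta z - v) * z ^+ n.+1 + w * (g z * z ^+ n.+1))).
    apply: meanT_eq => z z1; have zw := unit_neq w z w1 z1.
    by rewrite /g exprS; field.
  rewrite meanTD; [|apply: intTM => //; exact: L2_X|apply/intTZ/intTM => //; exact: L2_X].
  by rewrite meanTZ ?IH ?hardy_meanT_expr ?mulr0 ?addr0//; apply: intTM => //; exact: L2_X.
(* Using [theta conj(theta) = 1], the pairing becomes the Cauchy integral of [F]. The exponent
   [n.+1] pays for the [z] in [z / (z - w)] and leaves [F] with strictly negative frequencies
   only. *)
move=> n; pose F := fun z => (1 - v * (theta z)^*) * z^* ^+ n.+1.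
have hu : hardy (fun z => 1 + - v^* * theta z).
  exact: hardy_lin (hardy_cst 1) (inner_hardy _ hi).
have Lu := hardy_L2 _ hu.
have LF : L2 F.
  apply: (L2_eq (fun z => z^* ^+ n.+1 * (1 + - v^* * theta z)^*)); last exact/L2_JXM/L2J.
  by move=> z _; rewrite /F rmorphD rmorphM rmorphN rmorph1 /= conjCK; ring.
transitivity (meanT (fun z => F z * (z / (z - w)))).
  apply: meanT_eqT.
  - by apply: measTM; [exact: L2_meas|exact/measTJ/L2_meas/L2_inner/L2_X].
  - by apply: measTM; exact: L2_meas.
  apply: aeS (inner_unimod _ hi) => t tE It; rewrite /g /F rmorphM rmorphXn /= exprS.
  move: (tE It) (circ1 t); move: (theta (circ t)) => T; move: (circ t) => z TE z1.
  transitivity ((T * T^* - v * T^*) * z^* ^+ n / (z - w)); first by ring.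
  rewrite TE; transitivity ((1 - v * T^*) * (z * z^*) * z^* ^+ n / (z - w)); last by ring.
  by rewrite z1; ring.
rewrite -(disc_cauchy w F w1 LF); apply: disc_fourier0 => m.
transitivity (meanT (fun z => (1 + - v^* * theta z) * z ^+ (n + m).+1))^*.
  2: by rewrite hardy_meanT_expr// rmorph0.
rewrite -(meanTJ _ (intTM _ _ Lu (L2_X (n + m).+1))).
apply: meanT_eq => z _; rewrite /F !rmorphM rmorphD rmorphM rmorphN rmorph1 !rmorphXn /= conjCK.
by rewrite -addSn exprD; ring.
Qed.

(** Valid at every point of the circle, before [|theta| = 1] is used: measurability of the conjugate
    kernel is read off this form, as almost everywhere equality would not give it. *)
Lemma conj_kernelE w z : `|w| < 1 -> z * z^* = 1 ->
  conjK theta (kernelK theta w) z =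
  theta z * (1 - disc theta w * (theta z)^*) * (z - w)^-1.
Proof.
move=> w1 z1; have zw := unit_neq w z w1 z1.
rewrite /conjK /kernelK rmorphM /= fmorph_div rmorphB rmorphM rmorph1 /= conjCK.
rewrite rmorphB rmorphM rmorph1 /= conjCK.
have -> : 1 - w * z^* = z^* * (z - w) by rewrite mulrBr -z1; ring.
have z0 : z^* != 0.
  by apply/eqP => z0; move/eqP: z1; rewrite z0 mulr0 eq_sym oner_eq0.
by field; rewrite zw; exact: z0.
Qed.

Lemma conj_kernel_tilde w : `|w| < 1 ->
  eqT (conjK theta (kernelK theta w)) (kernelK_tilde theta w).
Proof.
move=> w1; apply: aeS (inner_unimod _ hi) => t tE It.
rewrite conj_kernelE ?circ1// /kernelK_tilde; congr (_ / _).
rewrite mulrBr mulr1 mulrCA mulrA [disc theta w * _]mulrC.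
by have := tE It; move: (theta _) => T TE; rewrite mulrAC TE mul1r.
Qed.

(** Here [z g = theta - v + w g], and [theta] is orthogonal to K_theta, which contains 1 and [g];
    hence [c = 1], and the compression gives [h (z g - theta + v) = w h g]. *)
Lemma eigen_div w f : `|w| < 1 -> disc theta w = v -> M f ->
  eqT f (fun z => h z * ((theta z - v) / (z - w))) -> eigenvector M w f.
Proof.
move=> w1 wv Mf fg; have Kg := div_theta_Kspace _ w1 wv.
have [_ _ PE] := compressed_shiftP _ _ Mf Kg fg.
have [Mg _] := iso _ Kg; have Lf := ML2 _ Mf.
have Ltv := L2B _ _ Lt (L2_cst v).
have Lg := L2_div _ _ w1 Ltv.
have tt : ip theta theta = 1 by rewrite ip_theta0 (ip_innerX _ hi).
have K_t f' : Kspace theta f' -> ip f' theta = 0.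
  by move=> K; rewrite ip_theta0 Kspace_X.
split => //.
  (* If [f] were 0, [theta] would equal [v] almost everywhere; then [v] is its mean [theta(0) = 0],
     against [|theta| = 1]. *)
  move=> f0; have gf0 := eqT_trans _ _ _ (eqT_sym _ _ fg) f0.
  have tv : eqT theta (fun=> v).
    apply: aeS (Kspace_eqT0 _ Kg gf0) => t H It; have := H It.
    move/eqP; rewrite mulf_eq0 invr_eq0 (negbTE (unit_neq w _ w1 (circ1 t))) orbF.
    by rewrite subr_eq0 => /eqP.
  have v0 : v = 0.
    rewrite -(meanT_cst v) -(meanT_eqT _ _ (L2_meas _ Lt) (measT_cst v) tv).
    by rewrite -disc0.
  have := ip_eqT _ _ _ _ Lt (L2_cst v) Lt (L2_cst v) tv tv.
  by rewrite tt /ip meanT_cst v0 mul0r => /eqP; rewrite oner_eq0.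
have c1 : ip (fun z => z * ((theta z - v) / (z - w))) theta = 1.
  transitivity (ip (fun z => (theta z + - v * 1) + w * ((theta z - v) / (z - w))) theta).
    apply: meanT_eq => z z1; congr (_ * _); have zw := unit_neq w z w1 z1.
    by field.
  rewrite (ip_linl _ _ _ _ (L2D _ _ Lt (L2Z _ _ (L2_cst 1))) Lg Lt).
  rewrite (ip_linl _ _ _ _ Lt (L2_cst 1) Lt) tt (K_t _ K1) (K_t _ Kg).
  by rewrite !mulr0 !addr0.
apply: eqT_trans PE _; apply: aeS fg => t ft It; rewrite ft// /shiftK c1.
have zw := unit_neq w _ w1 (circ1 t).
by field.
Qed.

Lemma eigen_conj_kernel w : `|w| < 1 -> disc theta w = v ->
  eqT (fun z => h z * conjK theta (kernelK theta w) z)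
      (fun z => h z * ((theta z - v) / (z - w))) /\
  eigenvector M w (fun z => h z * conjK theta (kernelK theta w) z).
Proof.
move=> w1 wv; have Kg := div_theta_Kspace _ w1 wv; have [Mg _] := iso _ Kg.
have E : eqT (fun z => h z * conjK theta (kernelK theta w) z)
      (fun z => h z * ((theta z - v) / (z - w))).
  by rewrite -wv; apply: eqTM; exact: conj_kernel_tilde.
split => //; apply: eigen_div => //; apply: Meq (eqT_sym _ _ E) => //.
apply: L2_eqT (ML2 _ Mg) _ (eqT_sym _ _ E); apply: measTM; first exact: L2_meas.
apply: (measT_eq (fun z => theta z * (1 + - disc theta w * (theta z)^*) * (z - w)^-1)).
  by move=> z z1; rewrite conj_kernelE// mulNr.
apply: measTM; last exact: measT_inv.
apply: measTM; first exact: L2_meas.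
by apply: L2_meas; apply: L2D; [exact: L2_cst|exact/L2Z/L2J].
Qed.

Lemma eigen_multiple w f : eigenvector M w f ->
  exists c, eqT f (fun z => c * (h z * conjK theta (kernelK theta w) z)).
Proof.
move=> ef; have w1 := eigen_lt1 _ _ ef; have wv := eigen_value _ _ ef.
have : M f by case: ef. rewrite {1}ME => -[_ [g [Kg fg]]].
have gE := eigen_eq _ _ _ ef Kg fg; have [E _] := eigen_conj_kernel _ w1 wv.
exists (ip (fun z => z * g z) theta).
apply: aeS2 (eqT_trans _ _ _ fg (eqTM _ _ h gE)) E => t H EE It.
by rewrite H// EE//; ring.
Qed.

Lemma point_spectrumE : point_spectrum M = [set w | `|w| < 1 /\ disc theta w = v].
Proof.
apply/seteqP; split => w /=.
  by move=> [f ef]; split; [exact: eigen_lt1 ef|exact: eigen_value ef].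
by move=> [w1 wv]; exists (fun z => h z * conjK theta (kernelK theta w) z);
  case: (eigen_conj_kernel _ w1 wv).
Qed.

End Main.

End Circle.

Theorem theorem3p8 (R : realType) (M : set (R[i] -> R[i]))
    (h theta : R[i] -> R[i])
    (hM : nearly_invariant M) (hMh : hitt M h theta) :
  let v : R[i] := meanT (fun z => theta z * `|h z| ^+ 2) in
  point_spectrum M = [set w : R[i] | `|w| < 1 /\ disc theta w = v] /\
  (forall w : R[i], point_spectrum M w ->
     [/\ eqT (fun z => h z * conjK theta (kernelK theta w) z)
             (fun z => h z * kernelK_tilde theta w z),
         eigenvector M w (fun z => h z * conjK theta (kernelK theta w) z) &
         forall f, eigenvector M w f ->
           exists c : R[i],
             eqT f (fun z => c * (h z * conjK theta (kernelK theta w) z))]).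
Proof.
move=> v; have PE := point_spectrumE _ _ _ hM hMh; split; first exact: PE.
move=> w; rewrite PE => -[w1 wv].
have [_ ew] := eigen_conj_kernel _ _ _ hM hMh _ w1 wv.
split; [|exact: ew|exact: (eigen_multiple _ _ _ hM hMh)].
apply: eqTM; apply: conj_kernel_tilde w1; exact: hMh.
Qed.
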